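(* Let $\mathbb{H}$ be a complex Hilbert space and let $T\in B(\mathbb{H})$. Then $$w^2(T)\leq \frac12\|T\|\left(\min_{t\in[0,1]}\|\widetilde{T}_t\|\right)+\frac14\|T^*T+TT^*\|.$$ In particular, $$w^2(T)\leq \frac12\|T\|\,\|\widetilde{T}\|+\frac14\|T^*T+TT^*\|.$$
   Context: $B(\mathbb{H})$ is the algebra of bounded linear operators on $\mathbb{H}$ and $\|\cdot\|$ the operator norm. The numerical radius is $w(T)=\sup\{|\langle Tx,x\rangle|: x\in\mathbb{H},\ \|x\|=1\}$, and $w^2(T)=(w(T))^2$. For $T\in B(\mathbb{H})$, $|T|=(T^*T)^{1/2}$ and $T=U|T|$ is the polar decomposition, with $U$ the partial isometry satisfying $\ker U=\ker T$. For $t\in[0,1]$ the $t$-Aluthge transform of $T$ is $\widetilde{T}_t=|T|^{t}U|T|^{1-t}$, with the convention $|T|^0:=U^*U$; $\widetilde{T}=\widetilde{T}_{1/2}=|T|^{1/2}U|T|^{1/2}$ is the Aluthge transform. *)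

(* Defs.v *)
From HB Require Import structures.
From mathcomp Require Import all_boot all_order all_algebra sesquilinear complex.
From mathcomp Require Import all_classical all_reals all_analysis.

Set Implicit Arguments.
Unset Strict Implicit.
Unset Printing Implicit Defensive.

Import Order.TTheory GRing.Theory Num.Theory.
Import numFieldNormedType.Exports.

Local Open Scope classical_set_scope.
Local Open Scope ring_scope.
Local Open Scope complex_scope.

(* Complex Hilbert spaces: Banach spaces over R[i] whose norm comes from an
   inner product, linear in its first argument and conjugate-linear in its
   second one. *)
HB.mixin Record CompleteNormedModule_isHilbert (R : realType) (H : Type)
    & CompleteNormedModule R[i] H := {
  inner : {dot H for Num.conj} ;
  innerxx : forall x : H, (inner : H -> H -> R[i]) x x = `|x| ^+ 2
}.

#[short(type="hilbertType")]
HB.structure Definition Hilbert (R : realType) :=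
  {H of CompleteNormedModule R[i] H & CompleteNormedModule_isHilbert R H}.

Notation "'<[' x , y ']>'" := (inner x y) (format "<[ x ,  y ]>") : ring_scope.

(* The norm `|x| on a normed module over R[i] takes values in R[i]; its
   imaginary part is zero, so that its real part is the usual real norm. *)
Definition rnorm (R : realType) (V : normedZmodType R[i]) (x : V) : R :=
  complex.Re `|x|.

Section Operators.
Variables (R : realType) (H : hilbertType R).
Implicit Types (A B S T U : H -> H) (f : R -> R) (t : R).

Definition bounded_op T : Prop :=
  linear T /\ exists M : R, forall x : H, rnorm (T x) <= M * rnorm x.

Definition opnorm T : R := sup [set rnorm (T x) | x in [set x : H | rnorm x <= 1]].

Definition num_radius T : R :=
  sup [set rnorm (<[T x, x]> : R[i]) | x in [set x : H | rnorm x = 1]].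

Definition adjoint T : H -> H :=
  xget 0 [set S | bounded_op S /\ forall x y, <[T x, y]> = <[x, S y]>].

(* p(A) *)
Definition op_horner (p : {poly R}) A : H -> H :=
  fun x => \sum_(i < size p) (p`_i)%:C *: iter i A x.

(* Continuous functional calculus: for A positive and f continuous on
   [0, ||A||], an interval containing the spectrum of A, f(A) is the limit in
   operator norm of p_n(A), where the polynomials p_n converge to f uniformly
   on [0, ||A||]. *)
Definition fun_calc f A : H -> H :=
  xget 0 [set B | bounded_op B /\ forall e : R, 0 < e -> exists p : {poly R},
    (forall x, 0 <= x <= opnorm A -> `|p.[x] - f x| <= e) /\
    opnorm (op_horner p A - B) <= e].

(* A^t, for A positive and t > 0 *)
Definition op_pow A t : H -> H := fun_calc (fun x => x `^ t) A.

Definition op_abs T : H -> H := op_pow (adjoint T \o T) 2^-1.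

Definition op_ker T : set H := [set x | T x = 0].

Definition partial_isometry U : Prop :=
  forall x, (forall y, op_ker U y -> <[x, y]> = 0) -> rnorm (U x) = rnorm x.

(* the factor U of the polar decomposition T = U |T| *)
Definition polar T : H -> H :=
  xget 0 [set U | [/\ bounded_op U, partial_isometry U,
                      T = U \o op_abs T & op_ker U = op_ker T]].

(* |T|^t, with the convention |T|^0 = U^* U *)
Definition abs_pow T t : H -> H :=
  if t == 0 then adjoint (polar T) \o polar T else op_pow (op_abs T) t.

Definition t_aluthge t T : H -> H := abs_pow T t \o polar T \o abs_pow T (1 - t).

Definition aluthge T : H -> H := abs_pow T 2^-1 \o polar T \o abs_pow T 2^-1.

End Operators.

(* Main.v *)
(* With T = U |T|, every t in [0, 1] gives T^2 = U |T|^(1-t) (|T|^t U |T|^(1-t)) |T|^t,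
   hence ||T^2|| <= ||T|| ||T~_t||; and w(T)^2 <= ||T^2|| / 2 + ||T^*T + TT^*|| / 4
   follows by expanding ||c T x + c^* T^* x||^2 for a suitable unimodular c.  The
   minimum over t is attained because t |-> |T|^t is strongly continuous on the
   whole of [0, 1], including t = 0 where |T|^0 is the projection U^*U, so that
   t |-> ||T~_t|| is lower semicontinuous.

   The functional calculus rests on ||p(A)|| <= max_[0, ||A||] |p| for A positive:
   if N = ||p(A)|| were larger, p^2 - N^2 would have no root in [0, ||A||];
   splitting it over the complex numbers, p(A)^2 - N^2 would be bounded below,
   whereas N^2 is an approximate eigenvalue of p(A)^2. *)

From HB Require Import structures.
Require Import Defs.
From mathcomp Require Import all_boot all_order all_algebra sesquilinear complex.
From mathcomp Require Import all_classical all_reals all_analysis.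
From mathcomp Require Import ring lra.

Set Implicit Arguments.
Unset Strict Implicit.
Unset Printing Implicit Defensive.

Import Order.TTheory GRing.Theory Num.Theory.
Import numFieldNormedType.Exports.

Local Open Scope classical_set_scope.
Local Open Scope ring_scope.
Local Open Scope complex_scope.

(** * Inner product and norm *)

Section HilbertBasics.
Variables (R : realType) (H : hilbertType R).
Implicit Types (x y z : H) (a b : R[i]) (r s : R).

(** The adjoint, f(A) and the polar factor are picked by [xget] with default 0, so each needs an
    existence proof before its properties can be used: Riesz representation, completeness in
    operator norm, and extension of the isometry |T| z |-> T z to the closed range. For f(A)
    uniqueness is proved as well, and the laws of exponents come from it: two operators that
    calculate the same function are equal.

    The delicate point is the dependence on t at the endpoints. For t in (0, 1] the power |T|^t is a
    value of the functional calculus; the projection |T|^0 need not be one, and t |-> |T|^t need not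
    be norm continuous at 0. Two facts repair this: every |T|^t vanishes on ker T, and |T|^t |T| is
    the calculus of r^t r for all t in [0, 1], a function Lipschitz in t uniformly in r because the
    factor r absorbs the singularity of ln r. As ker T + range |T| is dense and the |T|^t are
    uniformly bounded, strong continuity follows. *)

Definition rip x y : R := complex.Re (<[x, y]> : R[i]).

Lemma rnormE (V : normedZmodType R[i]) (x : V) : `|x| = (rnorm x)%:C.
Proof. by rewrite /rnorm RRe_real; [|exact/ger0_real/normr_ge0]. Qed.

Lemma rnorm_ge0 (V : normedZmodType R[i]) (x : V) : 0 <= rnorm x.
Proof. by rewrite -lecR -rnormE; exact: normr_ge0. Qed.

Lemma ler_rnormD (V : normedZmodType R[i]) (x y : V) :
  rnorm (x + y) <= rnorm x + rnorm y.
Proof. by rewrite -lecR rmorphD /= -!rnormE ler_normD. Qed.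

Lemma rnormN (V : normedZmodType R[i]) (x : V) : rnorm (- x) = rnorm x.
Proof. by rewrite /rnorm normrN. Qed.

Lemma rnorm_distC (V : normedZmodType R[i]) (x y : V) :
  rnorm (x - y) = rnorm (y - x).
Proof. by rewrite -opprB rnormN. Qed.

Lemma rnorm0 (V : normedZmodType R[i]) : rnorm (0 : V) = 0.
Proof. by rewrite /rnorm normr0. Qed.

Lemma rnorm0_eq0 (V : normedZmodType R[i]) (x : V) : rnorm x = 0 -> x = 0.
Proof. by move=> x0; apply/eqP; rewrite -normr_eq0 rnormE x0. Qed.

Lemma rnormZ a x : rnorm (a *: x) = rnorm a * rnorm x.
Proof. by apply: complexI; rewrite rmorphM /= -!rnormE normrZ. Qed.

Lemma rnormM a b : rnorm (a * b) = rnorm a * rnorm b.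
Proof. by apply: complexI; rewrite rmorphM /= -!rnormE normrM. Qed.

Lemma rnormR r : rnorm (r%:C : R[i]) = `|r|.
Proof. by rewrite /rnorm normc_def /= expr0n addr0 sqrtr_sqr. Qed.

Lemma rnormZr r x : rnorm (r%:C *: x) = `|r| * rnorm x.
Proof. by rewrite rnormZ rnormR. Qed.

Lemma innerC x y : (<[y, x]> : R[i]) = (<[x, y]>)^*%C.
Proof. by have := hermC (@inner R H) y x; rewrite /= expr0 mul1r. Qed.

Lemma innerDl x y z : (<[x + y, z]> : R[i]) = <[x, z]> + <[y, z]>.
Proof. by rewrite linearDl. Qed.
Lemma innerDr x y z : (<[x, y + z]> : R[i]) = <[x, y]> + <[x, z]>.
Proof. by rewrite linearDr. Qed.
Lemma innerZl a x y : (<[a *: x, y]> : R[i]) = a * <[x, y]>.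
Proof. by rewrite linearZl_LR. Qed.
Lemma innerZr a x y : (<[x, a *: y]> : R[i]) = a^*%C * <[x, y]>.
Proof. by rewrite linearZr_LR. Qed.
Lemma innerNl x y : (<[- x, y]> : R[i]) = - <[x, y]>.
Proof. by rewrite linearNl. Qed.
Lemma innerNr x y : (<[x, - y]> : R[i]) = - <[x, y]>.
Proof. by rewrite linearNr. Qed.
Lemma inner0l x : (<[0, x]> : R[i]) = 0.
Proof. by rewrite linear0l. Qed.
Lemma inner0r x : (<[x, 0]> : R[i]) = 0.
Proof. by rewrite linear0r. Qed.

Lemma ripC x y : rip x y = rip y x.
Proof. by rewrite /rip innerC; case: (<[y, x]> : R[i]). Qed.
Lemma ripDl x y z : rip (x + y) z = rip x z + rip y z.
Proof. by rewrite /rip innerDl raddfD. Qed.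
Lemma ripDr x y z : rip x (y + z) = rip x y + rip x z.
Proof. by rewrite /rip innerDr raddfD. Qed.
Lemma ripNl x y : rip (- x) y = - rip x y.
Proof. by rewrite /rip innerNl raddfN. Qed.
Lemma ripNr x y : rip x (- y) = - rip x y.
Proof. by rewrite /rip innerNr raddfN. Qed.
Lemma ripZl r x y : rip (r%:C *: x) y = r * rip x y.
Proof.
by rewrite /rip innerZl; case: (<[x, y]> : R[i]) => u v /=; rewrite mul0r subr0.
Qed.
Lemma ripZr r x y : rip x (r%:C *: y) = r * rip x y.
Proof. by rewrite ripC ripZl ripC. Qed.
Lemma ripxx x : rip x x = rnorm x ^+ 2.
Proof. by apply: complexI; rewrite /rip innerxx rnormE -rmorphXn. Qed.
Lemma rip0l x : rip 0 x = 0. Proof. by rewrite /rip inner0l. Qed.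

Definition ripE := (ripDl, ripDr, ripNl, ripNr, ripZl, ripZr).

(** Conjugate-linearity gives [<x, i y> = -i <x, y>], whose real part is the imaginary part of
    [<x, y>]. Most arguments can therefore use the real form [rip] alone. *)
Lemma inner_rip x y : (<[x, y]> : R[i]) = rip x y +i* rip x ('i%C *: y).
Proof.
rewrite /rip innerZr; case: (<[x, y]> : R[i]) => u v /=.
by congr (_ +i* _); rewrite mul0r sub0r mulN1r opprK.
Qed.

Lemma inner_rip0 x y : (<[x, y]> : R[i]) = 0 -> rip x y = 0.
Proof. by rewrite /rip => ->. Qed.

Lemma eq_rip x y : (forall z, rip x z = rip y z) -> x = y.
Proof.
move=> e; apply/eqP; rewrite -subr_eq0; apply/eqP/rnorm0_eq0/eqP.
by rewrite -sqrf_eq0 -ripxx ripDl ripNl e subrr.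
Qed.

Lemma eq_innerl x y : (forall z, (<[x, z]> : R[i]) = <[y, z]>) -> x = y.
Proof. by move=> e; apply: eq_rip => z; rewrite /rip e. Qed.

Lemma rnorm_parallelogram x y :
  rnorm (x + y) ^+ 2 + rnorm (x - y) ^+ 2 = 2 * rnorm x ^+ 2 + 2 * rnorm y ^+ 2.
Proof. by rewrite -!ripxx !(ripDl, ripDr, ripNl, ripNr) (ripC y x); ring. Qed.

Lemma rip_CS x y : `|rip x y| <= rnorm x * rnorm y.
Proof.
suff CS x' y' : rip x' y' <= rnorm x' * rnorm y'.
  by rewrite ler_norml lerNl CS andbT -ripNl -[in leRHS](rnormN x) CS.
have [->|y0] := eqVneq y' 0; first by rewrite ripC rip0l rnorm0 mulr0.
have ny : 0 < rnorm y'.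
  by rewrite lt_def rnorm_ge0 andbT; apply: contra y0 => /eqP/rnorm0_eq0 ->.
have [->|x0] := eqVneq x' 0; first by rewrite rip0l rnorm0 mul0r.
have nx : 0 < rnorm x'.
  by rewrite lt_def rnorm_ge0 andbT; apply: contra x0 => /eqP/rnorm0_eq0 ->.
(* With norms [u], [v] and [c = rip x' y'], this square expands to [2 u v (u v - c)]. *)
have := sqr_ge0 (rnorm ((rnorm y')%:C *: x' - (rnorm x')%:C *: y')).
rewrite -ripxx !ripE (ripC y' x') !ripxx.
set c := rip _ _; set u := rnorm x' in nx *; set v := rnorm y' in ny *.
move=> h; have : 0 <= (2 * (u * v)) * (u * v - c) by nra.
by rewrite pmulr_rge0 ?subr_ge0 // !mulr_gt0.
Qed.

Lemma ler_rip x y : rip x y <= rnorm x * rnorm y.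
Proof. exact: le_trans (ler_norm _) (rip_CS x y). Qed.

Lemma unimodular_rotation a : exists2 c : R[i], rnorm c = 1 & c * a = (rnorm a)%:C.
Proof.
have [->|a0] := eqVneq a 0; first by exists 1; rewrite ?rnorm0 ?mulr0 // -[1]/(1%:C) rnormR normr1.
have na : rnorm a != 0 by apply: contra a0 => /eqP/rnorm0_eq0 ->.
exists ((rnorm a)%:C / a); last by rewrite divfK.
have e : rnorm ((rnorm a)%:C / a) * rnorm a = rnorm a.
  by rewrite -rnormM divfK // rnormR ger0_norm // rnorm_ge0.
by rewrite -[LHS](mulfK na) e divff.
Qed.

Lemma inner_CS x y : rnorm (<[x, y]> : R[i]) <= rnorm x * rnorm y.
Proof.
have [c c1 e] := unimodular_rotation (<[x, y]> : R[i]).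
have : rip (c *: x) y = rnorm (<[x, y]> : R[i]) by rewrite /rip innerZl e.
by move=> <-; rewrite (le_trans (ler_rip _ _)) // rnormZ c1 mul1r.
Qed.

(** Testing with [y = x] suffices. This is how weak estimates become norm estimates, for the adjoint
    and for the minimum over [t]. *)
Lemma rnorm_le_rip x r : 0 <= r ->
  (forall y, rip x y <= r * rnorm y) -> rnorm x <= r.
Proof.
move=> r0 h; have := h x; rewrite ripxx expr2.
have [->//|x0] := eqVneq (rnorm x) 0.
by rewrite ler_pM2r // lt_def x0 rnorm_ge0.
Qed.

(** The library's Cauchy criterion has tolerances in [R[i]]; a positive element of [R[i]] is real,
    so real tolerances are enough. *)
Lemma hilbert_complete (u : nat -> H) :
  (forall e : R, 0 < e -> exists N, forall m n, (N <= m)%N -> (N <= n)%N ->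
    rnorm (u m - u n) <= e) ->
  exists l : H, forall e : R, 0 < e -> exists N, forall n, (N <= n)%N ->
    rnorm (u n - l) <= e.
Proof.
move=> cu; have cvu : cvg (u @ \oo).
  apply/cauchy_cvgP/cauchy_ballP => e e0.
  have [d d0 de] : exists2 d : R, 0 < d & e = d%:C :> R[i].
    have eR : (complex.Re (e : R[i]))%:C = e by apply/RRe_real/gtr0_real.
    by exists (complex.Re (e : R[i])); rewrite // -ltcR eR.
  have [N hN] := cu (d / 2) (divr_gt0 d0 (ltr0n _ 2)).
  exists (u @` [set n | (N <= n)%N], u @` [set n | (N <= n)%N]) => /=.
    by split; exists N => // n nN; exists n.
  move=> [_ _] /= [[m mN <-] [n nN <-]]; rewrite -ball_normE /= de rnormE ltcR.
  by rewrite (le_lt_trans (hN _ _ mN nN)) // ltr_pdivrMr // ltr_pMr // ltr1n.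
exists (lim (u @ \oo) : H) => e e0.
have e0' : (0 : R[i]) < e%:C by rewrite ltcR.
have [N _ hN] := (cvgrPdist_le _ _).1 cvu _ e0'.
by exists N => n nN; have := hN n nN; rewrite /= rnormE lecR rnorm_distC.
Qed.

End HilbertBasics.

(** * Orthogonal projections *)

Section Projection.
Variables (R : realType) (H : hilbertType R).
Implicit Types (x y z : H) (a b : R[i]) (r s : R) (V : set H).

Definition closed_subspace V : Prop :=
  [/\ V 0, forall a x y, V x -> V y -> V (a *: x + y) &
      forall x, (forall e : R, 0 < e -> exists2 v, V v & rnorm (x - v) <= e) -> V x].

Lemma invn_small (e : R) : 0 < e -> exists N, forall n, (N <= n)%N -> n.+1%:R^-1 <= e.
Proof.
move=> e0; exists (Num.bound e^-1) => n Nn.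
rewrite -[e]invrK lef_pV2 ?posrE ?invr_gt0 ?ltr0Sn //.
have h : e^-1 < (Num.bound e^-1)%:R by rewrite archi_boundP // invr_ge0 ltW.
by rewrite (le_trans (ltW h)) // ler_nat (leq_trans Nn).
Qed.

Lemma rnorm_sqrB x y : rnorm (x - y) ^+ 2 = rnorm x ^+ 2 - 2 * rip x y + rnorm y ^+ 2.
Proof. by rewrite -!ripxx !ripE (ripC y x); ring. Qed.

(** Midpoints stay in [V], so the parallelogram law bounds the squared distance of [u m] and [u n]
    by [2 / (m + 1) + 2 / (n + 1)]; hence the threshold [e ^+ 2 / 4]. *)
Lemma minimizing_cauchy x V (d : R) (u : nat -> H) : closed_subspace V ->
  (forall v, V v -> d <= rnorm (x - v) ^+ 2) ->
  (forall n, V (u n) /\ rnorm (x - u n) ^+ 2 <= d + n.+1%:R^-1) ->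
  forall e : R, 0 < e -> exists N, forall m n, (N <= m)%N -> (N <= n)%N ->
    rnorm (u m - u n) <= e.
Proof.
move=> [V0 VP _] dlow hu e e0.
have [N hN] : exists N, forall n, (N <= n)%N -> n.+1%:R^-1 <= e ^+ 2 / 4.
  by apply: invn_small; rewrite divr_gt0 ?exprn_gt0.
exists N => m n /hN hm /hN hn.
rewrite -(@ler_pXn2r _ 2) ?nnegrE ?rnorm_ge0 ?(ltW e0) //.
have := rnorm_parallelogram (x - u m) (x - u n).
have -> : x - u m + (x - u n) =
    (2%:R : R)%:C *: (x - ((2^-1 : R)%:C *: u m + (2^-1 : R)%:C *: u n)).
  rewrite scalerBr scalerDr !scalerA -!rmorphM /= divff ?pnatr_eq0 // !scale1r.
  by rewrite rmorph_nat scaler_nat mulr2n opprD addrACA.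
have -> : x - u m - (x - u n) = u n - u m by rewrite opprB addrC addrA subrK.
rewrite rnormZr normr_nat exprMn (rnorm_distC (u n)).
have /dlow h : V ((2^-1 : R)%:C *: u m + (2^-1 : R)%:C *: u n).
  apply: (VP); first by case: (hu m).
  by rewrite -[_ *: _]addr0; apply: VP => //; case: (hu n).
have [_ h1] := hu m; have [_ h2] := hu n.
move: hm hn h h1 h2; move: (m.+1%:R^-1) (n.+1%:R^-1) => p q.
move: (rnorm (x - (_ + _))) (rnorm (x - u m)) (rnorm (x - u n)) => A B C.
by move: (rnorm _) => E hp hq hA hB hC eqE; lra.
Qed.

(** First variation at a minimum. At [t = c / (W + 1)] the hypothesis reads
    [2 q <= q W / (W + 1) <= q] with [q = c^2 / (W + 1) >= 0], so [q = 0]; the [+ 1] covers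
    [W = 0]. *)
Lemma quad_ge0_lin0 (c W : R) : 0 <= W ->
  (forall t : R, 2 * t * c <= t ^+ 2 * W) -> c = 0.
Proof.
move=> W0 h; have W1 : 0 < W + 1 by lra.
have := h (c / (W + 1)) => h1.
have e : 2 * (c / (W + 1)) * c = 2 * (c ^+ 2 / (W + 1)) by ring.
have e2 : (c / (W + 1)) ^+ 2 * W = (c ^+ 2 / (W + 1)) * (W / (W + 1)).
  by field; rewrite gt_eqF.
have k : W / (W + 1) <= 1 by rewrite ler_pdivrMr // mul1r; lra.
have k0 : 0 <= c ^+ 2 / (W + 1) by rewrite divr_ge0 ?sqr_ge0 ?ltW.
have : c ^+ 2 / (W + 1) = 0 by nra.
move/eqP; rewrite mulf_eq0 invr_eq0 (gt_eqF W1) orbF sqrf_eq0.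
by move/eqP.
Qed.

Lemma orthogonal_projection V x : closed_subspace V ->
  exists2 v, V v & forall w, V w -> (<[x - v, w]> : R[i]) = 0.
Proof.
move=> cV; have [V0 VP Vc] := cV.
pose D := [set rnorm (x - v) ^+ 2 | v in V].
have D0 : D !=set0 by exists (rnorm (x - 0) ^+ 2), 0.
have hD : has_inf D.
  by split=> //; exists 0 => _ [v _ <-]; rewrite sqr_ge0.
pose d := inf D.
have dlow v : V v -> d <= rnorm (x - v) ^+ 2.
  by move=> Vv; apply: ge_inf; [exact: hD.2 | exists v].
have /choice[u hu] : forall n : nat, exists v,
    V v /\ rnorm (x - v) ^+ 2 <= d + n.+1%:R^-1.
  move=> n; have [|_ [v Vv <-] /ltW h] := @inf_adherent _ D n.+1%:R^-1 _ hD.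
    by rewrite invr_gt0 ltr0Sn.
  by exists v.
have [v hv] := hilbert_complete (minimizing_cauchy cV dlow hu).
have Vv : V v.
  apply: Vc => e /hv[N /(_ N (leqnn N))]; rewrite rnorm_distC => ?.
  by exists (u N) => //; case: (hu N).
exists v => // w Vw.
(* [V] is stable under multiplication by [i], so vanishing real parts suffice. *)
suff rip0 w' : V w' -> rip (x - v) w' = 0.
  rewrite inner_rip !rip0 //.
  by rewrite -[_ *: _]addr0; exact: VP.
move=> {}Vw {w}; set w := w' in Vw *.
apply: (@quad_ge0_lin0 _ (rnorm w ^+ 2)) => [|t]; first exact: sqr_ge0.
(* The limit [v] is replaced by a late [u n], with competitor [t w + u n] in [V]. Half of [e] pays
   for [1 / (n + 1)], the other half for [2 t rip (u n - v) w]. *)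
apply/ler_addgt0Pr => e e0.
have k0 : 0 < 2 * (2 * `|t| * rnorm w + 1).
  by have := mulr_ge0 (normr_ge0 t) (rnorm_ge0 w); nra.
have [N1 hN1] := hv _ (divr_gt0 e0 k0).
have [N2 hN2] : exists N, forall n, (N <= n)%N -> n.+1%:R^-1 <= e / 2.
  by apply: invn_small; rewrite divr_gt0.
pose n := maxn N1 N2.
have {}hN1 := hN1 n (leq_maxl _ _); have {}hN2 := hN2 n (leq_maxr _ _).
have Vn : V (t%:C *: w + u n) by apply: VP => //; case: (hu n).
have [_ h1] := hu n; have h2 := dlow _ Vn.
have E : x - (t%:C *: w + u n) = (x - u n) - t%:C *: w.
  by rewrite opprD addrCA addrC.
rewrite E rnorm_sqrB ripZr rnormZr exprMn real_normK ?num_real // in h2.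
have -> : rip (x - v) w = rip (x - u n) w + rip (u n - v) w.
  by rewrite -ripDl addrA subrK.
have h3 : 2 * t * rip (u n - v) w <= e / 2.
  have /ler_normlW : `|2 * t * rip (u n - v) w| <= e / 2.
    rewrite !normrM normr_nat.
    have := rip_CS (u n - v) w.
    move: hN1; rewrite ler_pdivlMr // => hN1 h.
    have := normr_ge0 t; have := rnorm_ge0 w; have := rnorm_ge0 (u n - v).
    have := ler_wpM2l (normr_ge0 t) h.
    move: hN1; set A := rnorm (u n - v); set B := rnorm w; set C := `|_|.
    by set D' := `|rip _ _|; nra.
  by [].
by move: h1 h2 hN2; set q := n.+1%:R^-1; lra.
Qed.

End Projection.

(** * Bounded operators and adjoints *)

Section BoundedOperators.
Variables (R : realType) (H : hilbertType R).
Implicit Types (x y z : H) (a b : R[i]) (r s c : R) (A B S T U : H -> H).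

Section Linearity.
Variables (T : H -> H) (hT : bounded_op T).

Lemma bounded_opD x y : T (x + y) = T x + T y.
Proof. by have := hT.1 1 x y; rewrite !scale1r. Qed.
Lemma bounded_op0 : T 0 = 0.
Proof. by apply: (@addrI _ (T 0)); rewrite -bounded_opD !addr0. Qed.
Lemma bounded_opZ a x : T (a *: x) = a *: T x.
Proof. by have := hT.1 a x 0; rewrite bounded_op0 !addr0. Qed.
Lemma bounded_opN x : T (- x) = - T x.
Proof. by rewrite -scaleN1r bounded_opZ scaleN1r. Qed.
Lemma bounded_opB x y : T (x - y) = T x - T y.
Proof. by rewrite bounded_opD bounded_opN. Qed.
Lemma bounded_op_sum (I : Type) (s : seq I) (F : I -> H) :
  T (\sum_(i <- s) F i) = \sum_(i <- s) T (F i).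
Proof. exact: (big_morph T bounded_opD bounded_op0). Qed.

Lemma bounded_op_ge0 : exists2 M : R, 0 <= M & forall x, rnorm (T x) <= M * rnorm x.
Proof.
have [_ [M hM]] := hT; exists `|M| => // x; apply: le_trans (hM x) _.
by rewrite ler_wpM2r ?rnorm_ge0 ?ler_norm.
Qed.

Lemma has_sup_opnorm : has_sup [set rnorm (T x) | x in [set x : H | rnorm x <= 1]].
Proof.
have [M M0 hM] := bounded_op_ge0; split.
  by exists (rnorm (T 0)), 0 => //=; rewrite rnorm0.
exists M => _ [x /= x1 <-]; apply: le_trans (hM x) _.
by rewrite ler_piMr.
Qed.

Lemma opnorm_ge0 : 0 <= opnorm T.
Proof.
apply: le_trans (rnorm_ge0 (T 0)) _; apply: sup_ubound; first exact: has_sup_opnorm.2.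
by exists 0 => //=; rewrite rnorm0.
Qed.

Lemma ler_opnorm x : rnorm (T x) <= opnorm T * rnorm x.
Proof.
have [->|x0] := eqVneq x 0; first by rewrite bounded_op0 !rnorm0 mulr0.
have nx : 0 < rnorm x.
  by rewrite lt_def rnorm_ge0 andbT; apply: contra x0 => /eqP/rnorm0_eq0 ->.
rewrite -ler_pdivrMr //.
have -> : rnorm (T x) / rnorm x = rnorm (T ((rnorm x)^-1%:C *: x)).
  by rewrite bounded_opZ rnormZr ger0_norm ?invr_ge0 ?rnorm_ge0 // mulrC.
apply: sup_ubound; first exact: has_sup_opnorm.2.
exists ((rnorm x)^-1%:C *: x) => //=.
by rewrite rnormZr ger0_norm ?invr_ge0 ?rnorm_ge0 // mulVf ?gt_eqF.
Qed.

End Linearity.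

Lemma opnorm_le T c : 0 <= c -> (forall x, rnorm (T x) <= c * rnorm x) -> opnorm T <= c.
Proof.
move=> c0 h; apply: ge_sup.
  by exists (rnorm (T 0)), 0 => //=; rewrite rnorm0.
by move=> _ [x /= x1 <-]; rewrite (le_trans (h x)) // ler_piMr.
Qed.

Lemma bounded_op_id : bounded_op (@id H).
Proof. by split=> //; exists 1 => x; rewrite mul1r. Qed.

Lemma bounded_op_comp S T : bounded_op S -> bounded_op T -> bounded_op (S \o T).
Proof.
move=> hS hT; split; first by move=> a x y /=; rewrite hT.1 hS.1.
have [M M0 hM] := bounded_op_ge0 hS; have [N N0 hN] := bounded_op_ge0 hT.
exists (M * N) => x /=; apply: le_trans (hM _) _.
by rewrite -mulrA ler_wpM2l.
Qed.

Lemma bounded_op_add S T : bounded_op S -> bounded_op T -> bounded_op (S + T).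
Proof.
move=> hS hT; split.
  by move=> a x y /=; rewrite !fctE hT.1 hS.1 scalerDr addrACA.
have [M M0 hM] := bounded_op_ge0 hS; have [N N0 hN] := bounded_op_ge0 hT.
exists (M + N) => x; rewrite fctE (le_trans (ler_rnormD _ _)) //.
by rewrite mulrDl lerD.
Qed.

Lemma bounded_op_scale a T : bounded_op T -> bounded_op (fun x => a *: T x).
Proof.
move=> hT; split.
  by move=> b x y /=; rewrite hT.1 scalerDr !scalerA mulrC.
have [M M0 hM] := bounded_op_ge0 hT.
by exists (rnorm a * M) => x; rewrite rnormZ -mulrA ler_wpM2l ?rnorm_ge0.
Qed.

Lemma bounded_op_sub S T : bounded_op S -> bounded_op T -> bounded_op (S - T).
Proof.
move=> hS hT; have -> : S - T = S + (fun x => -1 *: T x).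
  by apply/funext => x; rewrite !fctE scaleN1r.
by apply: bounded_op_add => //; exact: bounded_op_scale.
Qed.

Lemma bounded_op_iter n T : bounded_op T -> bounded_op (iter n T).
Proof.
move=> hT; elim: n => [|n IH]; first exact: bounded_op_id.
exact: (bounded_op_comp hT IH).
Qed.

Lemma bounded_op_bigsum (I : Type) (s : seq I) (F : I -> H -> H) :
  (forall i, bounded_op (F i)) -> bounded_op (fun x => \sum_(i <- s) F i x).
Proof.
move=> hF; elim: s => [|i s IH].
  rewrite (_ : (fun _ => _) = (fun x => 0 *: id x)).
    exact/bounded_op_scale/bounded_op_id.
  by apply/funext => x; rewrite big_nil scale0r.
rewrite (_ : (fun _ => _) = F i + (fun x => \sum_(i <- s) F i x)).
  exact: bounded_op_add.
by apply/funext => x; rewrite big_cons fctE.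
Qed.

Lemma opnorm_distC S T : opnorm (S - T) = opnorm (T - S).
Proof.
rewrite /opnorm; congr sup; apply/seteqP; split=> _ [x x1 <-]; exists x => //;
by rewrite !fctE rnorm_distC.
Qed.

Lemma opnorm_triangle A B S : bounded_op A -> bounded_op B -> bounded_op S ->
  opnorm (A - B) <= opnorm (A - S) + opnorm (S - B).
Proof.
move=> hA hB hS; apply: opnorm_le => [|x].
  by rewrite addr_ge0 // opnorm_ge0 //; exact: bounded_op_sub.
have -> : (A - B) x = (A - S) x + (S - B) x by rewrite !fctE addrA subrK.
rewrite (le_trans (ler_rnormD _ _)) // mulrDl lerD ?ler_opnorm //;
exact: bounded_op_sub.
Qed.

Lemma opnorm_eq0 S T : bounded_op S -> bounded_op T -> opnorm (S - T) <= 0 -> S = T.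
Proof.
move=> hS hT h; apply/funext => x; apply/eqP; rewrite -subr_eq0; apply/eqP/rnorm0_eq0/eqP.
rewrite eq_le rnorm_ge0 andbT; apply: le_trans (ler_opnorm (bounded_op_sub hS hT) x) _.
by rewrite mulr_le0_ge0 ?rnorm_ge0.
Qed.

(** Take [w] orthogonal to ker f with [f w != 0]. Then [f w *: x - f x *: w] lies in ker f, and
    pairing it with [w] gives [f w <x, w> = f x <w, w>]. *)
Lemma riesz (f : H -> R[i]) (M : R) :
  (forall a x y, f (a *: x + y) = a * f x + f y) ->
  (forall x, rnorm (f x) <= M * rnorm x) ->
  exists y, forall x, f x = <[x, y]>.
Proof.
move=> fP fM; have f0 : f 0 = 0.
  by have := fP (-1) 0 0; rewrite scaler0 addr0 mulN1r addNr.
have [h|/existsNP[x0 nx0]] := pselect (forall x, f x = 0).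
  by exists 0 => x; rewrite h inner0r.
have cK : closed_subspace [set x | f x = 0].
  split=> //=; first by move=> a x y /= fx fy; rewrite fP fx fy mulr0 addr0.
  move=> x hx; apply/rnorm0_eq0/eqP; rewrite eq_le rnorm_ge0 andbT.
  apply/ler_addgt0Pr => e e0; rewrite add0r.
  have M1 : 0 < `|M| + 1 by rewrite ltr_wpDl.
  have [v /= fv xv] := hx _ (divr_gt0 e0 M1).
  have -> : f x = f (x - v).
    by rewrite -scaleN1r addrC fP fv mulr0 add0r.
  apply: le_trans (fM _) _; move: xv; rewrite ler_pdivlMr //.
  have := rnorm_ge0 (x - v); have := ler_norm M; set A := rnorm _; set B := `|_|.
  by nra.
have [v /= fv hv] := orthogonal_projection x0 cK.
set w := x0 - v in hv.
have fw : f w = f x0 by rewrite /w -scaleN1r addrC fP fv mulr0 add0r.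
have fw0 : f w != 0 by rewrite fw; apply/eqP.
have ww0 : (<[w, w]> : R[i]) != 0.
  rewrite innerxx expf_neq0 // normr_eq0; apply: contra fw0 => /eqP ->.
  by rewrite f0.
exists ((f w / <[w, w]>)^*%C *: w) => x.
have /hv : f (f w *: x - f x *: w) = 0.
  by rewrite fP -scaleNr -[_ *: w]addr0 fP f0 addr0 mulNr mulrC subrr.
rewrite innerC => /(congr1 conjc); rewrite conjcK conjc0.
rewrite innerDl innerNl !innerZl => /eqP; rewrite subr_eq0 => /eqP e.
by rewrite innerZr conjcK mulrAC e mulfK.
Qed.

Lemma adjoint_spec T : bounded_op T ->
  bounded_op (adjoint T) /\ forall x y, (<[T x, y]> : R[i]) = <[x, adjoint T y]>.
Proof.
move=> hT; suff : exists S, bounded_op S /\ forall x y, <[T x, y]> = <[x, S y]>.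
  case=> S hS; rewrite /adjoint; case: xgetP => [S' -> //|/(_ S)].
  by move/(_ hS).
have /choice[S hS] : forall y, exists z, forall x, (<[T x, y]> : R[i]) = <[x, z]>.
  move=> y; apply: (@riesz (fun x => <[T x, y]>) (opnorm T * rnorm y)).
    by move=> a x z; rewrite hT.1 innerDl innerZl.
  move=> x; apply: le_trans (inner_CS _ _) _.
  by rewrite mulrAC ler_wpM2r ?rnorm_ge0 ?ler_opnorm.
exists S; split; last by move=> x y; rewrite hS.
split.
  move=> a x y; apply: eq_innerl => z; rewrite [LHS]innerC [RHS]innerC.
  by rewrite -hS !innerDr !innerZr !hS.
exists (opnorm T) => y; apply: rnorm_le_rip => [|z].
  by rewrite mulr_ge0 ?opnorm_ge0 ?rnorm_ge0.
rewrite ripC /rip -hS; apply: le_trans (ler_rip _ _) _.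
by rewrite mulrAC ler_wpM2r ?rnorm_ge0 ?ler_opnorm.
Qed.

End BoundedOperators.

(** * Polynomials in a positive operator *)

Section PolynomialCalculus.
Variables (R : realType) (H : hilbertType R).
Implicit Types (x y z : H) (a b : R[i]) (r s c : R) (A B S T U : H -> H).

(** Complex coefficients allow [p] to be split into linear factors. *)
Definition chorner (p : {poly R[i]}) A : H -> H :=
  fun x => \sum_(i < size p) p`_i *: iter i A x.

Lemma op_horner_chorner (p : {poly R}) A :
  op_horner p A = chorner (map_poly (real_complex R) p) A.
Proof.
by apply/funext => x; rewrite /chorner size_map_poly; apply: eq_bigr => i _; rewrite coef_map.
Qed.

Section FixedOperator.
Variables (A : H -> H) (hA : bounded_op A).

Lemma chorner_widen n (p : {poly R[i]}) x : (size p <= n)%N ->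
  chorner p A x = \sum_(i < n) p`_i *: iter i A x.
Proof.
move=> pn; rewrite /chorner (big_ord_widen n (fun i => p`_i *: iter i A x)) //.
rewrite big_mkcond; apply: eq_bigr => i _; case: ltnP => // ip.
by rewrite nth_default // scale0r.
Qed.

Lemma bounded_chorner p : bounded_op (chorner p A).
Proof.
apply: (@bounded_op_bigsum _ _ _ _ (fun i : 'I_(size p) => fun x => p`_i *: iter i A x)).
by move=> i; apply/bounded_op_scale/bounded_op_iter.
Qed.

Lemma bounded_op_horner (p : {poly R}) : bounded_op (op_horner p A).
Proof. by rewrite op_horner_chorner; exact: bounded_chorner. Qed.

Lemma chorner0 : chorner 0 A = fun=> 0.
Proof. by apply/funext => x; rewrite /chorner size_poly0 big_ord0. Qed.

Lemma chornerD p q x : chorner (p + q) A x = chorner p A x + chorner q A x.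
Proof.
pose n := maxn (size p) (size q).
rewrite !(@chorner_widen n) ?leq_maxl ?leq_maxr ?size_polyD // -big_split /=.
by apply: eq_bigr => i _; rewrite coefD scalerDl.
Qed.

Lemma chornerZ a p x : chorner (a *: p) A x = a *: chorner p A x.
Proof.
rewrite (chorner_widen _ (size_scale_leq a p)) scaler_sumr.
by apply: eq_bigr => i _; rewrite coefZ scalerA.
Qed.

Lemma chornerC a x : chorner a%:P A x = a *: x.
Proof.
by rewrite (@chorner_widen 1) ?size_polyC_leq1 // big_ord1 coefC eqxx.
Qed.

Lemma chornerMX p x : chorner (p * 'X) A x = chorner p A (A x).
Proof.
rewrite (@chorner_widen (size p).+1); last first.
  by rewrite (leq_trans (size_polyMleq _ _)) // size_polyX addn2.
rewrite big_ord_recl coefMX eqxx scale0r add0r; apply: eq_bigr => i _.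
by rewrite coefMX /= -iterS iterSr.
Qed.

Lemma chorner_comm p x : chorner p A (A x) = A (chorner p A x).
Proof.
rewrite /chorner (bounded_op_sum hA); apply: eq_bigr => i _.
by rewrite (bounded_opZ hA) -iterS iterSr.
Qed.

Lemma chornerM p q : chorner (p * q) A = chorner p A \o chorner q A.
Proof.
elim/poly_ind: p => [|p a IH]; first by rewrite mul0r chorner0.
apply/funext => x /=; rewrite mulrDl mulrAC mul_polyC !chornerD chornerZ !chornerMX.
by rewrite IH /= chorner_comm chornerC.
Qed.

Lemma chornerXsubC a x : chorner ('X - a%:P) A x = A x - a *: x.
Proof.
by rewrite -polyCN chornerD chornerC scaleNr -['X]mul1r chornerMX chornerC scale1r.
Qed.

Lemma op_hornerM (p q : {poly R}) : op_horner (p * q) A = op_horner p A \o op_horner q A.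
Proof. by rewrite !op_horner_chorner rmorphM chornerM. Qed.

Lemma op_hornerD (p q : {poly R}) : op_horner (p + q) A = op_horner p A + op_horner q A.
Proof. by apply/funext => x; rewrite fctE !op_horner_chorner rmorphD chornerD. Qed.

Lemma op_hornerC r x : op_horner r%:P A x = r%:C *: x.
Proof. by rewrite op_horner_chorner map_polyC chornerC. Qed.

Lemma op_hornerN (p : {poly R}) : op_horner (- p) A = - op_horner p A.
Proof.
apply/funext => x; rewrite -mulN1r op_hornerM /= -polyCN op_hornerC rmorphN scaleN1r.
by [].
Qed.

Lemma op_hornerB (p q : {poly R}) : op_horner (p - q) A = op_horner p A - op_horner q A.
Proof. by rewrite op_hornerD op_hornerN. Qed.

Lemma op_hornerX : op_horner 'X A = A.
Proof.
by apply/funext => x; rewrite op_horner_chorner map_polyX -['X]mul1r chornerMX chornerC scale1r.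
Qed.

Lemma op_horner_ker (p : {poly R}) x : A x = 0 -> op_horner p A x = (p.[0])%:C *: x.
Proof.
move=> Ax; elim/poly_ind: p => [|p c IH].
  by rewrite op_horner_chorner rmorph0 chorner0 horner0 scale0r.
rewrite op_hornerD fctE op_hornerC op_hornerM /= op_hornerX Ax.
by rewrite (bounded_op0 (bounded_op_horner p)) add0r hornerMXaddC mulr0 add0r.
Qed.

End FixedOperator.

(** For complex-linear [A] this real condition already is self-adjointness: replace [y] by [i y]. *)
Definition symmetric_op A := forall x y, rip (A x) y = rip x (A y).

Lemma symmetric_op_horner (p : {poly R}) A : bounded_op A -> symmetric_op A ->
  symmetric_op (op_horner p A).
Proof.
move=> hA sA; elim/poly_ind: p => [|p c IH] x y.
  by rewrite op_horner_chorner rmorph0 chorner0 rip0l ripC rip0l.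
rewrite op_hornerD !fctE !op_hornerC op_hornerM //= op_hornerX //.
rewrite ripDl ripDr ripZl ripZr; congr (_ + _).
by rewrite IH sA !op_horner_chorner chorner_comm.
Qed.

Definition positive_op A :=
  [/\ bounded_op A, symmetric_op A & forall x, 0 <= rip (A x) x].

Lemma ripZlxx a x : rip (a *: x) x = complex.Re a * rnorm x ^+ 2.
Proof.
rewrite /rip innerZl innerxx rnormE -rmorphXn; case: a => u v /=.
by rewrite mulr0 subr0.
Qed.

Lemma rip_il x y : rip ('i%C *: x) y = - rip x ('i%C *: y).
Proof.
rewrite /rip innerZl innerZr; case: (<[x, y]> : R[i]) => u v /=.
by ring.
Qed.

Lemma ripZlxi a x : rip (a *: x) ('i%C *: x) = complex.Im a * rnorm x ^+ 2.
Proof.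
rewrite ripC rip_il -(ripC (_ *: _)) scalerA ripZlxx; case: a => u v /=.
by ring.
Qed.

Lemma rip_symmetric_i A x : bounded_op A -> symmetric_op A ->
  rip (A x) ('i%C *: x) = 0.
Proof.
move=> hA sA; suff : rip (A x) ('i%C *: x) = - rip (A x) ('i%C *: x) by lra.
by rewrite {1}sA (bounded_opZ hA) -[in RHS]rip_il ripC.
Qed.

(* That is, the approximate spectrum of A lies in [0, ||A||]. *)
Lemma positive_op_below A a : positive_op A ->
  (forall r, 0 <= r <= opnorm A -> a != r%:C) ->
  exists2 d : R, 0 < d & forall x, d * rnorm x <= rnorm (A x - a *: x).
Proof.
move=> [hA sA pA] ha.
have key (d : R) (y : H -> H) : (forall x, d * rnorm x ^+ 2 <= rnorm (A x - a *: x) * rnorm x) ->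
    forall x, d * rnorm x <= rnorm (A x - a *: x).
  move=> h x; have [->|x0] := eqVneq (rnorm x) 0; first by rewrite mulr0 rnorm_ge0.
  have nx : 0 < rnorm x by rewrite lt_def x0 rnorm_ge0.
  by rewrite -(ler_pM2r nx) -mulrA -expr2.
(* Three ways to miss the interval. For non-real [a], [<A x, x>] is real, so pairing [A x - a x]
   with [i x] leaves a gap [|Im a|]; for real [a], pairing with [x] leaves [- a] on the left of 0
   and [a - opnorm A] on the right of the norm. *)
have [im0|im0] := eqVneq (complex.Im a) 0; last first.
  exists `|complex.Im a|; first by rewrite normr_gt0.
  apply: key => // x.
  have := rip_CS (A x - a *: x) ('i%C *: x).
  rewrite ripDl ripNl rip_symmetric_i // sub0r ripZlxi normrN normrM.
  rewrite [`|_ ^+ 2|]ger0_norm ?sqr_ge0 // rnormZ.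
  suff -> : rnorm ('i%C : R[i]) = 1 by rewrite mul1r.
  by rewrite /rnorm normc_def /= expr0n add0r expr1n sqrtr1.
have ea : a = (complex.Re a)%:C by move: im0; case: (a) => u v /= ->.
have [re0|re0] := ltP (complex.Re a) 0.
  exists (- complex.Re a); first by rewrite oppr_gt0.
  apply: key => // x; apply: le_trans (ler_rip (A x - a *: x) x).
  by rewrite ripDl ripNl ripZlxx mulNr lerDr.
have reA : opnorm A < complex.Re a.
  rewrite ltNge; apply/negP => h; have := ha (complex.Re a).
  by rewrite re0 h => /(_ isT); rewrite -ea eqxx.
exists (complex.Re a - opnorm A); first by rewrite subr_gt0.
apply: key => // x; rewrite -[rnorm (_ - _)]rnormN.
apply: le_trans (ler_rip (- (A x - a *: x)) x).
rewrite ripNl ripDl ripNl ripZlxx opprD opprK mulrBl addrC lerD2r lerN2.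
apply: le_trans (ler_rip _ _) _.
by rewrite expr2 mulrA ler_wpM2r ?rnorm_ge0 ?ler_opnorm.
Qed.

(** Each linear factor of [p] is bounded below because its root avoids the interval, and lower
    bounds multiply under composition. *)
Lemma chorner_below A (p : {poly R[i]}) : positive_op A -> p != 0 ->
  (forall r, 0 <= r <= opnorm A -> ~~ root p r%:C) ->
  exists2 d : R, 0 < d & forall x, d * rnorm x <= rnorm (chorner p A x).
Proof.
move=> pA p0; have [hA _ _] := pA.
have [s ->] := closed_field_poly_normal p.
move=> hr; have : forall r, 0 <= r <= opnorm A -> ~~ root (\prod_(z <- s) ('X - z%:P)) r%:C.
  by move=> r /hr; rewrite rootZ // lead_coef_eq0.
move=> {}hr; suff [d d0 hd] : exists2 d : R, 0 < d & forall x,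
    d * rnorm x <= rnorm (chorner (\prod_(z <- s) ('X - z%:P)) A x).
  exists (rnorm (lead_coef p) * d).
    rewrite mulr_gt0 // lt_def rnorm_ge0 andbT; move: p0; rewrite -lead_coef_eq0.
    by apply: contra => /eqP/rnorm0_eq0 ->.
  by move=> x; rewrite chornerZ rnormZ -mulrA ler_wpM2l ?rnorm_ge0.
elim: s hr => [|a s IH] hr.
  by exists 1 => // x; rewrite big_nil chornerC // scale1r mul1r.
have [|d d0 hd] := IH.
  by move=> r /hr; rewrite big_cons rootM negb_or => /andP[].
have [|d' d'0 hd'] := positive_op_below (a := a) pA.
  by move=> r /hr; rewrite big_cons rootM negb_or root_XsubC eq_sym => /andP[].
exists (d' * d); first by rewrite mulr_gt0.
move=> x; rewrite big_cons chornerM //= chornerXsubC //.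
by apply: le_trans (hd' _); rewrite -mulrA ler_wpM2l ?(ltW d'0).
Qed.

(** Expand the square and use [|A (A x)| <= N |A x|]. Unit vectors on which [A] nearly attains its
    norm are thus approximate eigenvectors of [A^2] for [N^2]. *)
Lemma opnorm_symmetric_sqr A (N : R) x : bounded_op A -> symmetric_op A -> opnorm A = N ->
  rnorm (A (A x) - (N ^+ 2)%:C *: x) ^+ 2 <= N ^+ 2 * (N ^+ 2 * rnorm x ^+ 2 - rnorm (A x) ^+ 2).
Proof.
move=> hA sA eN; rewrite rnorm_sqrB ripZr sA ripxx rnormZr exprMn.
rewrite [`|_|]ger0_norm ?sqr_ge0 //.
have := ler_opnorm hA (A x); rewrite eN => h.
have : rnorm (A (A x)) ^+ 2 <= N ^+ 2 * rnorm (A x) ^+ 2.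
  by rewrite -exprMn ler_pXn2r // nnegrE ?mulr_ge0 ?rnorm_ge0 // -eN opnorm_ge0.
move: (rnorm (A (A x))) (rnorm (A x)) (rnorm x) => a b c; lra.
Qed.

Lemma opnorm_op_horner A (p : {poly R}) c : positive_op A ->
  (forall r, 0 <= r <= opnorm A -> `|p.[r]| <= c) -> opnorm (op_horner p A) <= c.
Proof.
move=> pA hp; have [hA sA _] := pA; rewrite leNgt; apply/negP => cN.
have hB := bounded_op_horner hA p; set B := op_horner p A in hB cN *.
have sB : symmetric_op B by exact: symmetric_op_horner.
pose N := opnorm B.
have A0 : 0 <= (0 : R) <= opnorm A by rewrite lexx opnorm_ge0.
have N0 : 0 < N by apply: le_lt_trans cN; apply: le_trans (hp _ A0).
have pN r : 0 <= r <= opnorm A -> (p ^+ 2 - (N ^+ 2)%:P).[r] != 0.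
  move=> /hp h; rewrite hornerD hornerN hornerC horner_exp subr_eq0.
  rewrite -real_normK ?num_real // lt_eqF // ltr_pXn2r ?nnegrE ?(ltW N0) //.
  exact: le_lt_trans cN.
pose q := map_poly (real_complex R) (p ^+ 2 - (N ^+ 2)%:P).
have q0 : q != 0.
  by rewrite map_poly_eq0; apply: contra (pN _ A0) => /eqP ->; rewrite horner0.
have [|d d0 hd] := chorner_below pA q0.
  by move=> r /pN; rewrite /root horner_map fmorph_eq0.
have hq x : chorner q A x = B (B x) - (N ^+ 2)%:C *: x.
  by rewrite -op_horner_chorner op_hornerB // fctE expr2 op_hornerM // !fctE op_hornerC.
(* The lower bound [d] on [B^2 - N^2] gives [d^2 |x|^2 <= N^2 (N^2 |x|^2 - |B x|^2)], so the norm of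
   [B] is at most the square root of [N^2 - (d/N)^2], which is below [N]: a contradiction. *)
have h x : rnorm (B x) <= Num.sqrt (N ^+ 2 - (d / N) ^+ 2) * rnorm x.
  have := hd x; rewrite hq => h1.
  have h2 := opnorm_symmetric_sqr x hB sB (erefl N).
  have h3 : d ^+ 2 * rnorm x ^+ 2 <= N ^+ 2 * (N ^+ 2 * rnorm x ^+ 2 - rnorm (B x) ^+ 2).
    apply: le_trans h2; rewrite -exprMn ler_pXn2r ?nnegrE ?rnorm_ge0 //.
    by rewrite mulr_ge0 ?rnorm_ge0 ?(ltW d0).
  have h4 : rnorm (B x) ^+ 2 <= (N ^+ 2 - (d / N) ^+ 2) * rnorm x ^+ 2.
    rewrite -(ler_pM2l (exprn_gt0 2 N0)).
    have -> : N ^+ 2 * ((N ^+ 2 - (d / N) ^+ 2) * rnorm x ^+ 2) =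
      N ^+ 2 * (N ^+ 2 * rnorm x ^+ 2) - d ^+ 2 * rnorm x ^+ 2.
      by field; rewrite gt_eqF.
    by move: h3; rewrite mulrBr; lra.
  rewrite -[rnorm x]ger0_norm ?rnorm_ge0 // -sqrtr_sqr -[rnorm (B x)]ger0_norm ?rnorm_ge0 //.
  rewrite -sqrtr_sqr.
  (* [Num.sqrt] is 0 on negative numbers; in that case [B x] has norm 0. *)
  have [e|e] := leP 0 (N ^+ 2 - (d / N) ^+ 2).
    by rewrite -sqrtrM // ler_sqrt // mulr_ge0 ?sqr_ge0.
  have : rnorm (B x) ^+ 2 <= 0 by apply: le_trans h4 _; rewrite nmulr_rle0 ?sqr_ge0.
  by move=> /ler0_sqrtr ->; rewrite mulr_ge0 ?sqrtr_ge0.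
have := opnorm_le (sqrtr_ge0 _) h; rewrite -/N leNgt => /negP; apply.
rewrite -[X in _ < X]ger0_norm ?(ltW N0) // -sqrtr_sqr ltr_sqrt ?exprn_gt0 //.
by rewrite ltrBlDr ltrDl exprn_gt0 // divr_gt0.
Qed.

End PolynomialCalculus.

(** * Polynomial approximation of powers *)

Section PowerApproximation.
Variable R : realType.
Implicit Types (g : nat -> R) (t x y a b c d e M : R).

(* Bernstein polynomials on [0, 1] with nodal values [g 0, .., g n], built by
   de Casteljau's recursion. *)
Fixpoint bernstein n g : {poly R} :=
  if n is m.+1 then (1 - 'X) * bernstein m g + 'X * bernstein m (g \o S)
  else (g 0%N)%:P.

(** The weights of the nodes are binomial, with mean [n x] and variance [n x (1 - x)], so the mean
    of [(k - d)^2] is [(n x - d)^2 + n x (1 - x)]. The centre [d] is free because the induction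
    shifts it to [d - 1]. *)
Lemma bernstein_dist n g x a b c d : 0 <= x <= 1 ->
  (forall k, (k <= n)%N -> `|g k - c| <= a + b * (k%:R - d) ^+ 2) ->
  `|(bernstein n g).[x] - c| <= a + b * ((n%:R * x - d) ^+ 2 + n%:R * x * (1 - x)).
Proof.
move=> /andP[x0 x1]; elim: n g d => [|n IH] g d hg /=.
  by have := hg 0%N isT; rewrite hornerC !mul0r addr0.
have h1 := IH g d (fun k kn => hg k (leqW kn)).
have h2 : `|(bernstein n (g \o S)).[x] - c| <=
    a + b * ((n%:R * x - (d - 1)) ^+ 2 + n%:R * x * (1 - x)).
  apply: IH => k kn /=; have := hg k.+1 kn.
  by rewrite -natr1 -addrA opprB [1 - d]addrC.
rewrite hornerD !hornerM hornerD hornerN hornerX hornerC.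
set u := (bernstein n g).[x] in h1 *; set v := (bernstein n _).[x] in h2 *.
have -> : (1 - x) * u + x * v - c = (1 - x) * (u - c) + x * (v - c) by ring.
apply: le_trans (ler_normD _ _) _; rewrite !normrM.
rewrite [`|x|]ger0_norm // [`|1 - x|]ger0_norm ?subr_ge0 //.
have x1' : 0 <= 1 - x by rewrite subr_ge0.
apply: le_trans (lerD (ler_wpM2l x1' h1) (ler_wpM2l x0 h2)) _.
rewrite -natr1 le_eqVlt; apply/orP; left; apply/eqP; ring.
Qed.

(** Write [u^t = u * u^(t - 1)]; the second factor is nonincreasing since [t <= 1]. *)
Lemma powR_subadd t x y : 0 < t <= 1 -> 0 <= x -> 0 <= y ->
  (x + y) `^ t <= x `^ t + y `^ t.
Proof.
move=> /andP[t0 t1]; rewrite le_eqVlt => /predU1P[<-|x0].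
  by rewrite add0r lerDr powR_ge0.
rewrite le_eqVlt => /predU1P[<-|y0]; first by rewrite addr0 lerDl powR_ge0.
have mono u v : 0 < u -> u <= v -> v `^ (t - 1) <= u `^ (t - 1).
  move=> u0 uv; have v0 := lt_le_trans u0 uv.
  rewrite -[t - 1]opprB !powRN lef_pV2 ?posrE ?powR_gt0 //.
  by rewrite ge0_ler_powR ?nnegrE ?subr_ge0 // ltW.
have E u : 0 < u -> u `^ t = u * u `^ (t - 1).
  by move=> u0; rewrite mulr_powRB1 // ltW.
rewrite (E x) // (E y) // (E (x + y)) ?addr_gt0 // mulrDl.
by apply: lerD; rewrite ler_wpM2l ?(ltW x0) ?(ltW y0) // mono // (lerDl, lerDr) ltW.
Qed.

Lemma ler_powRl t x y : 0 <= t -> 0 <= x -> x <= y -> x `^ t <= y `^ t.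
Proof.
by move=> t0 x0 xy; rewrite ge0_ler_powR ?nnegrE // (le_trans x0 xy).
Qed.

Lemma powR_dist t x y : 0 < t <= 1 -> 0 <= x -> 0 <= y ->
  `|x `^ t - y `^ t| <= `|x - y| `^ t.
Proof.
move=> ht; wlog xy : x y / y <= x.
  move=> h x0 y0; have [/h|/ltW/h] := leP y x; first exact.
  by rewrite distrC [`|y - x|]distrC; apply.
move=> x0 y0; have /andP[t0 _] := ht.
rewrite !ger0_norm ?subr_ge0 ?ler_powRl ?(ltW t0) //.
by rewrite lerBlDl -{1}[x](subrK y) addrC powR_subadd ?subr_ge0.
Qed.

Lemma powR_approx01 t e : 0 < t <= 1 -> 0 < e ->
  exists p : {poly R}, forall x, 0 <= x <= 1 -> `|p.[x] - x `^ t| <= e.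
Proof.
move=> ht e0; have /andP[t0 t1] := ht.
have e20 : 0 < e / 2 by rewrite divr_gt0.
(* [d] is the distance at which [d^t = e / 2]. *)
pose d := (e / 2) `^ t^-1; have d0 : 0 < d by rewrite powR_gt0.
have [N hN] : exists N, forall n, (N <= n)%N -> n.+1%:R^-1 <= e / 2 * d ^+ 2.
  by apply: invn_small; rewrite mulr_gt0 ?exprn_gt0.
pose n := N.+1; pose g (k : nat) : R := (k%:R / n%:R) `^ t.
exists (bernstein n g) => x x01; have /andP[x0 x1] := x01.
have n0 : 0 < n%:R :> R by rewrite ltr0Sn.
(* A quadratic majorant of the modulus of continuity: below [d] the term [e / 2] suffices, beyond it
   [h^t <= 1 <= h^2 / d^2]. This is the shape that [bernstein_dist] accepts. *)
have hd h : 0 <= h <= 1 -> h `^ t <= e / 2 + h ^+ 2 / d ^+ 2.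
  move=> /andP[h0 h1]; have [hd|/ltW hd] := leP h d.
    have : h `^ t <= d `^ t by rewrite ler_powRl // ltW.
    rewrite /d -powRrM mulVf ?gt_eqF // powRr1 ?(ltW e20) // => /le_trans; apply.
    by rewrite lerDl divr_ge0 ?sqr_ge0.
  have : h `^ t <= 1 `^ t by rewrite ler_powRl // ltW.
  rewrite powR1 => /le_trans; apply.
  apply: le_trans (_ : h ^+ 2 / d ^+ 2 <= _); last by rewrite lerDr ltW.
  by rewrite ler_pdivlMr ?exprn_gt0 // mul1r ler_pXn2r ?nnegrE // ltW.
have := @bernstein_dist n g x (e / 2) (n%:R ^+ 2 * d ^+ 2)^-1 (x `^ t) (n%:R * x) x01.
rewrite subrr expr0n add0r => H.
have {}H : `|(bernstein n g).[x] - x `^ t| <=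
    e / 2 + (n%:R ^+ 2 * d ^+ 2)^-1 * (n%:R * x * (1 - x)).
  apply: H => k kn; rewrite /g; apply: le_trans (powR_dist ht _ x0) _.
    by rewrite divr_ge0.
  have kn1 : k%:R / n%:R <= 1 :> R by rewrite ler_pdivrMr // mul1r ler_nat.
  have kn0 : 0 <= k%:R / n%:R :> R by rewrite divr_ge0.
  apply: le_trans (hd _ _) _.
    by rewrite normr_ge0 /= ler_norml; apply/andP; split; lra.
  rewrite lerD2l real_normK ?num_real // le_eqVlt; apply/orP; left; apply/eqP.
  by field; rewrite !gt_eqF.
apply: le_trans H _; rewrite [leRHS](splitr e) lerD2l.
have hn := hN N (leqnn N); rewrite -/n in hn.
have -> : (n%:R ^+ 2 * d ^+ 2)^-1 * (n%:R * x * (1 - x)) = (n%:R^-1 / d ^+ 2) * (x * (1 - x)).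
  by field; rewrite !gt_eqF.
apply: le_trans (_ : n%:R^-1 / d ^+ 2 <= _).
  by rewrite ler_piMr ?divr_ge0 ?sqr_ge0 ?invr_ge0 ?(ltW n0) //; nra.
by rewrite ler_pdivrMr ?exprn_gt0.
Qed.

Definition approximable M (f : R -> R) := forall e, 0 < e ->
  exists p : {poly R}, forall x, 0 <= x <= M -> `|p.[x] - f x| <= e.

Lemma powR_approximable M t : 0 <= M -> 0 < t <= 1 -> approximable M (fun x => x `^ t).
Proof.
move=> M0 ht e e0; have /andP[t0 t1] := ht.
move: M0; rewrite le_eqVlt => /predU1P[<-|M0].
  (* Here [M = 0], so the interval is [{0}], where the power vanishes because [t > 0]; otherwise
     rescale to [0, 1]. *)
  exists 0 => x; rewrite -eq_le => /eqP <-.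
  by rewrite horner0 powR0 ?gt_eqF // subrr normr0 ltW.
have Mt : 0 < M `^ t by rewrite powR_gt0.
have [p hp] := powR_approx01 ht (divr_gt0 e0 Mt).
exists (M `^ t *: (p \Po (M^-1 *: 'X))) => x /andP[x0 xM].
rewrite hornerZ horner_comp hornerZ hornerX.
have xe : x `^ t = M `^ t * (M^-1 * x) `^ t.
  rewrite -[RHS]powRM ?(ltW M0) ?mulr_ge0 ?invr_ge0 ?(ltW M0) //.
  by rewrite mulrA divff ?mul1r ?gt_eqF.
rewrite xe -mulrBr normrM ger0_norm ?(ltW Mt) // mulrC -ler_pdivlMr //; apply: hp.
by rewrite mulr_ge0 ?invr_ge0 ?(ltW M0) //= mulrC ler_pdivrMr // mul1r.
Qed.

Lemma approximable_bounded M (f : R -> R) : 0 <= M -> approximable M f ->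
  exists2 F, 0 <= F & forall x, 0 <= x <= M -> `|f x| <= F.
Proof.
move=> M0 /(_ 1 ltr01)[p hp]; exists (1 + \sum_(i < size p) `|p`_i| * M ^+ i).
  by rewrite addr_ge0 // sumr_ge0 // => i _; rewrite mulr_ge0 ?exprn_ge0.
move=> x xM; have /andP[x0 x1] := xM.
have -> : f x = (f x - p.[x]) + p.[x] by rewrite subrK.
apply: le_trans (ler_normD _ _) _; rewrite lerD //; first by rewrite distrC hp.
rewrite horner_coef; apply: le_trans (ler_norm_sum _ _ _) _.
apply: ler_sum => i _; rewrite normrM normrX ler_wpM2l //.
by rewrite ger0_norm // lerXn2r ?nnegrE.
Qed.

End PowerApproximation.

(** * Continuous functional calculus *)

Section FunctionalCalculus.
Variables (R : realType) (H : hilbertType R).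
Implicit Types (x y z : H) (a b : R[i]) (r s c t e : R) (A B C S T U : H -> H).
Implicit Types (f g : R -> R).

Lemma ler_divMl e c r : 0 <= e -> 0 < c -> r <= c -> e / c * r <= e.
Proof. by move=> e0 c0 rc; rewrite mulrAC ler_pdivrMr // ler_wpM2l. Qed.

Lemma opnorm_complete (u : nat -> H -> H) : (forall n, bounded_op (u n)) ->
  (forall e, 0 < e -> exists N, forall m n, (N <= m)%N -> (N <= n)%N ->
    opnorm (u m - u n) <= e) ->
  exists2 B : H -> H, bounded_op B &
    forall e, 0 < e -> exists N, forall n, (N <= n)%N -> opnorm (u n - B) <= e.
Proof.
move=> hu cu.
have diff m n x e : opnorm (u m - u n) <= e -> rnorm (u m x - u n x) <= e * rnorm x.
  move=> h; apply: le_trans (ler_opnorm (bounded_op_sub (hu m) (hu n)) x) _.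
  by rewrite ler_wpM2r ?rnorm_ge0.
have pos x : 0 < rnorm x + 1 by rewrite ltr_wpDl ?rnorm_ge0.
have /choice[B hB] : forall x, exists l, forall e, 0 < e ->
    exists N, forall n, (N <= n)%N -> rnorm (u n x - l) <= e.
  move=> x; apply: hilbert_complete => e e0.
  have [N hN] := cu _ (divr_gt0 e0 (pos x)).
  exists N => m n mN nN; apply: le_trans (diff _ _ _ _ (hN _ _ mN nN)) _.
  by rewrite ler_divMl ?(ltW e0) // lerDl.
(* Letting [m] grow in the Cauchy bound gives a single [N] for all [x]; linearity, boundedness and
   norm convergence of [B] all rest on this. *)
have BN e : 0 < e -> exists N, forall n, (N <= n)%N -> forall x,
    rnorm (u n x - B x) <= e * rnorm x.
  move=> e0; have [N hN] := cu e e0; exists N => n nN x.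
  apply/ler_addgt0Pr => d d0; have [N' hN'] := hB x d d0.
  pose m := maxn N N'.
  have -> : u n x - B x = (u n x - u m x) + (u m x - B x) by rewrite addrA subrK.
  rewrite (le_trans (ler_rnormD _ _)) // lerD ?hN' ?leq_maxr //.
  by rewrite diff // hN // leq_maxl.
have linB : linear B.
  move=> a x y; apply/eqP; rewrite -subr_eq0; apply/eqP/rnorm0_eq0/eqP.
  rewrite eq_le rnorm_ge0 andbT; apply/ler_addgt0Pr => e e0; rewrite add0r.
  pose K := rnorm (a *: x + y) + rnorm a * rnorm x + rnorm y + 1.
  have K0 : 0 < K.
    by rewrite ltr_wpDl // !addr_ge0 ?mulr_ge0 ?rnorm_ge0.
  have [N /(_ N (leqnn N)) hN] := BN _ (divr_gt0 e0 K0).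
  have -> : B (a *: x + y) - (a *: B x + B y) =
    - (u N (a *: x + y) - B (a *: x + y)) + (a *: (u N x - B x) + (u N y - B y)).
    rewrite (hu N).1 scalerBr opprB.
    rewrite [a *: u N x + u N y]addrC.
    rewrite [_ - a *: B x + _]addrACA [a *: u N x + u N y]addrC -opprD.
    by rewrite addrA subrK.
  apply: le_trans (ler_rnormD _ _) _; rewrite rnormN.
  apply: le_trans (lerD (hN _) (ler_rnormD _ _)) _; rewrite rnormZ.
  apply: le_trans (lerD (lexx _) (lerD (ler_wpM2l (rnorm_ge0 _) (hN _)) (hN _))) _.
  by rewrite mulrCA -!mulrDr ler_divMl ?(ltW e0) // /K addrA lerDl.
have bB : bounded_op B.
  split=> //; have [N /(_ N (leqnn N)) hN] := BN 1 ltr01.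
  exists (opnorm (u N) + 1) => x.
  have -> : B x = u N x + - (u N x - B x) by rewrite opprB addrC subrK.
  rewrite (le_trans (ler_rnormD _ _)) // rnormN mulrDl lerD ?ler_opnorm //.
exists B => // e e0; have [N hN] := BN e e0; exists N => n nN.
by apply: opnorm_le (ltW e0) _ => x; exact: hN.
Qed.

(** The property from which [fun_calc] selects, kept as a predicate so that differences and products
    can be formed on any candidate and then compared by uniqueness. *)
Definition is_calc A f B := bounded_op B /\ forall e, 0 < e ->
  exists p : {poly R}, (forall r, 0 <= r <= opnorm A -> `|p.[r] - f r| <= e) /\
    opnorm (op_horner p A - B) <= e.

Section FixedOperator.
Variables (A : H -> H) (pA : positive_op A).

Let hA : bounded_op A. Proof. by case: pA. Qed.
Let itv0 : 0 <= (0 : R) <= opnorm A. Proof. by rewrite lexx opnorm_ge0. Qed.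

Lemma is_calc_approximable f B : is_calc A f B -> approximable (opnorm A) f.
Proof. by move=> [_ h] e /h[p [hp _]]; exists p. Qed.

Lemma opnorm_horner_sub (p q : {poly R}) f e d :
  (forall r, 0 <= r <= opnorm A -> `|p.[r] - f r| <= e) ->
  (forall r, 0 <= r <= opnorm A -> `|q.[r] - f r| <= d) ->
  opnorm (op_horner p A - op_horner q A) <= e + d.
Proof.
move=> hp hq; rewrite -op_hornerB //; apply: opnorm_op_horner => // r hr.
have -> : (p - q).[r] = (p.[r] - f r) - (q.[r] - f r).
  by rewrite hornerD hornerN opprB addrA subrK.
by apply: le_trans (ler_normB _ _) _; rewrite lerD ?hp ?hq.
Qed.

(** Approximants within [1 / (n + 1)] of [f] give a Cauchy sequence of operators, since the norm of
    a polynomial in [A] is controlled by its values on the interval. *)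
Lemma fun_calcP f : approximable (opnorm A) f -> is_calc A f (fun_calc f A).
Proof.
move=> hf; suff [B hB] : exists B, is_calc A f B.
  rewrite /fun_calc; case: xgetP => [C -> //|/(_ B)]; by move/(_ hB).
have /choice[p hp] : forall n : nat, exists p : {poly R},
    forall r, 0 <= r <= opnorm A -> `|p.[r] - f r| <= n.+1%:R^-1.
  by move=> n; apply: hf; rewrite invr_gt0 ltr0Sn.
have [||B hB lB] := @opnorm_complete (fun n => op_horner (p n) A).
- by move=> n; exact: bounded_op_horner.
- move=> e e0; have [N hN] := invn_small (divr_gt0 e0 (ltr0n _ 2)).
  exists N => m n /hN hm /hN hn; apply: le_trans (opnorm_horner_sub (hp m) (hp n)) _.
  by rewrite [leRHS](splitr e) lerD.
exists B; split=> // e e0; have [N hN] := lB e e0; have [N' hN'] := invn_small e0.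
pose n := maxn N N'; exists (p n); split; last exact/hN/leq_maxl.
by move=> x /hp/le_trans; apply; exact/hN'/leq_maxr.
Qed.

Lemma is_calc_uniq f B C : is_calc A f B -> is_calc A f C -> B = C.
Proof.
move=> [hB cB] [hC cC]; apply: opnorm_eq0 => //; apply/ler_addgt0Pr => e e0.
(* Four quarters: [B] to [p(A)], then two for [p(A)] to [q(A)] through [f], and [q(A)] to [C]. *)
rewrite add0r; have e4 : 0 < e / 4 by rewrite divr_gt0.
have [p [hp hpB]] := cB _ e4; have [q [hq hqC]] := cC _ e4.
have bp := bounded_op_horner hA p; have bq := bounded_op_horner hA q.
have h := opnorm_horner_sub hp hq; rewrite opnorm_distC in hpB.
have h1 := opnorm_triangle hB hC bp; have h2 := opnorm_triangle bp hC bq.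
move: h h1 h2 hpB hqC.
move: (opnorm _) (opnorm _) (opnorm _) (opnorm _) (opnorm _) => i j k l m.
by move=> *; lra.
Qed.

Lemma eq_is_calc f g B : (forall r, 0 <= r <= opnorm A -> f r = g r) ->
  is_calc A f B -> is_calc A g B.
Proof.
move=> fg [hB cB]; split=> // e /cB[p [hp hpB]]; exists p; split=> // x xA.
by rewrite -fg // hp.
Qed.

Lemma is_calc_id : is_calc A id A.
Proof.
split=> // e e0; exists 'X; split; first by move=> x _; rewrite hornerX subrr normr0 ltW.
rewrite op_hornerX // subrr; apply: opnorm_le (ltW e0) _ => x.
by rewrite -[(0 : H -> H) x]/(0 : H) rnorm0 mulr_ge0 ?(ltW e0) ?rnorm_ge0.
Qed.

Lemma is_calc_sub f g B C : is_calc A f B -> is_calc A g C ->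
  is_calc A (f - g) (B - C).
Proof.
move=> [hB cB] [hC cC]; split; first exact: bounded_op_sub.
move=> e e0; have e2 : 0 < e / 2 by rewrite divr_gt0.
have [p [hp hpB]] := cB _ e2; have [q [hq hqC]] := cC _ e2.
have bp := bounded_op_horner hA p; have bq := bounded_op_horner hA q.
exists (p - q); split.
  move=> x xA; rewrite hornerD hornerN fctE.
  have -> : p.[x] - q.[x] - (f x - g x) = (p.[x] - f x) - (q.[x] - g x) by ring.
  by apply: le_trans (ler_normB _ _) _; rewrite [leRHS](splitr e) lerD ?hp ?hq.
rewrite op_hornerB //; apply: opnorm_le (ltW e0) _ => x.
have -> : (op_horner p A - op_horner q A - (B - C)) x =
    (op_horner p A - B) x - (op_horner q A - C) x.
  rewrite !fctE !opprB addrACA [RHS]addrACA; congr (_ + _); exact: addrC.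
apply: le_trans (ler_rnormD _ _) _; rewrite rnormN (splitr e) mulrDl.
by apply: lerD; (apply: le_trans (ler_opnorm _ _) _; [exact: bounded_op_sub |
  by rewrite ler_wpM2r ?rnorm_ge0]).
Qed.

Lemma is_calc_mul f g B C : is_calc A f B -> is_calc A g C ->
  is_calc A (f * g) (B \o C).
Proof.
move=> cB' cC'; have [hB cB] := cB'; have [hC cC] := cC'.
have [F F0 hF] := approximable_bounded (opnorm_ge0 hA) (is_calc_approximable cB').
have [G G0 hG] := approximable_bounded (opnorm_ge0 hA) (is_calc_approximable cC').
split; first exact: bounded_op_comp.
move=> e e0; pose K := F + G + opnorm B + opnorm C + 1.
have B0 := opnorm_ge0 hB; have C0 := opnorm_ge0 hC.
have K0 : 0 < K by rewrite ltr_wpDl // !addr_ge0.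
(* [d <= 1] makes the product of two errors at most [d]; [K] is large enough for both the scalar and
   the operator expansion. *)
pose d := Num.min 1 (e / K).
have d0 : 0 < d by rewrite lt_min ltr01 divr_gt0.
have d1 : d <= 1 by rewrite ge_min lexx.
have dK : d * K <= e by rewrite -ler_pdivlMr // ge_min lexx orbT.
have [p [hp hpB]] := cB _ d0; have [q [hq hqC]] := cC _ d0.
have bp := bounded_op_horner hA p; have bq := bounded_op_horner hA q.
exists (p * q); split.
  move=> x xA; rewrite hornerM fctE.
  have -> : p.[x] * q.[x] - f x * g x =
    (p.[x] - f x) * (q.[x] - g x) + (p.[x] - f x) * g x + f x * (q.[x] - g x) by ring.
  apply: le_trans (ler_normD _ _) _; apply: le_trans (lerD (ler_normD _ _) (lexx _)) _.
  rewrite !normrM; apply: le_trans dK.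
  have h1 : `|p.[x] - f x| * `|q.[x] - g x| <= d * 1.
    by rewrite ler_pM // ?hp // (le_trans _ d1) // hq.
  have h2 : `|p.[x] - f x| * `|g x| <= d * G by rewrite ler_pM // ?hp ?hG.
  have h3 : `|f x| * `|q.[x] - g x| <= F * d by rewrite ler_pM // ?hq ?hF.
  by apply: le_trans (lerD (lerD h1 h2) h3) _; rewrite /K; nra.
rewrite op_hornerM //; apply: opnorm_le (ltW e0) _ => x.
have -> : ((op_horner p A \o op_horner q A) - (B \o C)) x =
   (op_horner p A - B) ((op_horner q A - C) x) + (op_horner p A - B) (C x)
     + B ((op_horner q A - C) x).
  by rewrite !fctE /= (bounded_opB bp) !(bounded_opB hB) addrAC subrK addrA subrK.
have hpx y : rnorm ((op_horner p A - B) y) <= d * rnorm y.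
  apply: le_trans (ler_opnorm (bounded_op_sub bp hB) _) _.
  by rewrite ler_wpM2r ?rnorm_ge0.
have hqx : rnorm ((op_horner q A - C) x) <= d * rnorm x.
  apply: le_trans (ler_opnorm (bounded_op_sub bq hC) _) _.
  by rewrite ler_wpM2r ?rnorm_ge0.
apply: le_trans (ler_rnormD _ _) _; apply: le_trans (lerD (ler_rnormD _ _) (lexx _)) _.
apply: le_trans (_ : d * K * rnorm x <= _); last by rewrite ler_wpM2r ?rnorm_ge0.
have x0 := rnorm_ge0 x.
have h1 : rnorm ((op_horner p A - B) ((op_horner q A - C) x)) <= d * (1 * rnorm x).
  apply: le_trans (hpx _) _; rewrite ler_wpM2l ?(ltW d0) //.
  by apply: le_trans hqx _; rewrite ler_wpM2r.
have h2 : rnorm ((op_horner p A - B) (C x)) <= d * (opnorm C * rnorm x).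
  by apply: le_trans (hpx _) _; rewrite ler_wpM2l ?(ltW d0) ?ler_opnorm.
have h3 : rnorm (B ((op_horner q A - C) x)) <= opnorm B * (d * rnorm x).
  by apply: le_trans (ler_opnorm hB _) _; rewrite ler_wpM2l.
apply: le_trans (lerD (lerD h1 h2) h3) _.
have -> : d * K * rnorm x = d * (1 * rnorm x) + d * (opnorm C * rnorm x) +
    opnorm B * (d * rnorm x) + d * (F + G) * rnorm x by rewrite /K; ring.
by rewrite lerDl !mulr_ge0 ?addr_ge0 // ltW.
Qed.

Lemma is_calc_opnorm f B c : is_calc A f B ->
  (forall r, 0 <= r <= opnorm A -> `|f r| <= c) -> opnorm B <= c.
Proof.
move=> [hB cB] hc; apply/ler_addgt0Pr => e e0.
have [p [hp hpB]] := cB _ (divr_gt0 e0 (ltr0n _ 2)).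
have bp := bounded_op_horner hA p.
have h : opnorm (op_horner p A) <= c + e / 2.
  apply: opnorm_op_horner => // r hr; rewrite -[p.[r]](subrK (f r)) addrC.
  by apply: le_trans (ler_normD _ _) _; rewrite lerD ?hc ?hp.
have c0 : 0 <= c by apply: le_trans (hc 0 itv0).
apply: opnorm_le => [|x]; first by rewrite addr_ge0 ?(ltW e0).
have -> : B x = op_horner p A x - (op_horner p A - B) x.
  by rewrite !fctE opprB addrC subrK.
apply: le_trans (ler_rnormD _ _) _; rewrite rnormN (splitr e) addrA mulrDl.
apply: lerD; first by apply: le_trans (ler_opnorm bp _) _; rewrite ler_wpM2r ?rnorm_ge0.
by apply: le_trans (ler_opnorm (bounded_op_sub bp hB) _) _; rewrite ler_wpM2r ?rnorm_ge0.
Qed.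

Lemma is_calc_symmetric f B : is_calc A f B -> symmetric_op B.
Proof.
move=> [hB cB] x y; have [_ sA _] := pA.
apply/eqP; rewrite -subr_eq0 -normr_le0; apply/ler_addgt0Pr => e e0; rewrite add0r.
pose K := 2 * (rnorm x * rnorm y) + 1.
have K0 : 0 < K by rewrite ltr_wpDl // !mulr_ge0 ?rnorm_ge0.
have [p [_ hpB]] := cB _ (divr_gt0 e0 K0).
have bp := bounded_op_horner hA p.
have hd z : rnorm ((op_horner p A - B) z) <= e / K * rnorm z.
  apply: le_trans (ler_opnorm (bounded_op_sub bp hB) _) _.
  by rewrite ler_wpM2r ?rnorm_ge0.
have -> : rip (B x) y - rip x (B y) =
    rip x ((op_horner p A - B) y) - rip ((op_horner p A - B) x) y.
  rewrite !fctE ripDl ripDr ripNl ripNr (symmetric_op_horner p hA sA).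
  by ring.
apply: le_trans (ler_normB _ _) _; apply: le_trans (lerD (rip_CS _ _) (rip_CS _ _)) _.
apply: le_trans (lerD (ler_wpM2l (rnorm_ge0 x) (hd y)) (ler_wpM2r (rnorm_ge0 y) (hd x))) _.
have -> : rnorm x * (e / K * rnorm y) + e / K * rnorm x * rnorm y =
   e / K * (2 * (rnorm x * rnorm y)) by ring.
by rewrite ler_divMl ?(ltW e0) // /K lerDl.
Qed.

(** On ker A a polynomial in [A] acts as its value at 0, and this passes to the limit. *)
Lemma is_calc_ker f B x : is_calc A f B -> A x = 0 -> B x = (f 0)%:C *: x.
Proof.
move=> [hB cB] Ax; apply/eqP; rewrite -subr_eq0; apply/eqP/rnorm0_eq0/eqP.
rewrite eq_le rnorm_ge0 andbT; apply/ler_addgt0Pr => e e0; rewrite add0r.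
pose K := 2 * rnorm x + 1.
have K0 : 0 < K by rewrite ltr_wpDl // !mulr_ge0 ?rnorm_ge0.
have [p [hp hpB]] := cB _ (divr_gt0 e0 K0).
have bp := bounded_op_horner hA p.
have -> : B x - (f 0)%:C *: x = (p.[0] - f 0)%:C *: x - (op_horner p A - B) x.
  by rewrite !fctE op_horner_ker // rmorphB scalerBl opprB [RHS]addrC addrA subrK.
apply: le_trans (ler_rnormD _ _) _; rewrite rnormN rnormZr.
apply: le_trans (_ : e / K * rnorm x + e / K * rnorm x <= _).
  apply: lerD; first by rewrite ler_wpM2r ?rnorm_ge0 // hp.
  apply: le_trans (ler_opnorm (bounded_op_sub bp hB) _) _.
  by rewrite ler_wpM2r ?rnorm_ge0.
by rewrite -mulrDr -mulr2n -mulr_natl ler_divMl ?(ltW e0) // /K lerDl.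
Qed.

End FixedOperator.
End FunctionalCalculus.

(** * Powers, absolute value and partial isometries *)

Section OperatorPowers.
Variables (R : realType) (H : hilbertType R).
Implicit Types (x y z : H) (a b : R[i]) (r s c t e : R) (A B C S T U : H -> H).

Section FixedOperator.
Variables (A : H -> H) (pA : positive_op A).

Lemma op_powP t : 0 < t <= 1 -> is_calc A (fun r => r `^ t) (op_pow A t).
Proof.
move=> ht; apply: fun_calcP => //; apply: powR_approximable => //.
by apply: opnorm_ge0; case: pA.
Qed.

Lemma op_powD s t : 0 < s -> 0 < t -> s + t <= 1 ->
  op_pow A s \o op_pow A t = op_pow A (s + t).
Proof.
move=> s0 t0 st; apply: (is_calc_uniq pA (f := fun r => r `^ (s + t))); last first.
  by apply: op_powP; rewrite addr_gt0.
have hs : 0 < s <= 1 by rewrite s0 (le_trans _ st) // lerDl ltW.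
have ht : 0 < t <= 1 by rewrite t0 (le_trans _ st) // lerDr ltW.
apply: eq_is_calc (is_calc_mul pA (op_powP hs) (op_powP ht)) => r _.
by rewrite /= powRD // gt_eqF // addr_gt0.
Qed.

Lemma op_pow1 : op_pow A 1 = A.
Proof.
apply: (is_calc_uniq pA (f := id)); last exact: is_calc_id.
have h1 : 0 < (1 : R) <= 1 by rewrite ltr01 lexx.
by apply: eq_is_calc (op_powP h1) => r /andP[r0 _]; rewrite powRr1.
Qed.

Lemma op_pow_positive t : 0 < t <= 1 -> positive_op (op_pow A t).
Proof.
move=> ht; have ct := op_powP ht; split; first by case: ct.
  exact: is_calc_symmetric ct.
move=> x; have /andP[t0 t1] := ht; have t20 : 0 < t / 2 by rewrite divr_gt0.
have ht2 : 0 < t / 2 <= 1.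
  by rewrite t20 (le_trans _ t1) // ler_pdivrMr // ler_peMr ?(ltW t0) // ler1n.
(* [A^t] is the square of the symmetric operator [A^(t/2)], so [<A^t x, x>] is a squared norm. *)
rewrite (splitr t) -op_powD -?splitr //= (is_calc_symmetric pA (op_powP ht2)).
by rewrite ripxx sqr_ge0.
Qed.

Lemma opnorm_op_pow t : 0 < t <= 1 -> opnorm (op_pow A t) <= opnorm A `^ t.
Proof.
move=> ht; apply: (is_calc_opnorm pA (op_powP ht)) => r /andP[r0 r1].
by rewrite ger0_norm ?powR_ge0 // ler_powRl //; case/andP: ht => /ltW.
Qed.

Lemma op_pow_ker t x : 0 < t <= 1 -> A x = 0 -> op_pow A t x = 0.
Proof.
move=> ht /(is_calc_ker pA (op_powP ht)) ->.
by rewrite powR0 ?scale0r // gt_eqF //; case/andP: ht.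
Qed.

End FixedOperator.

Section AbsoluteValue.
Variables (T : H -> H) (hT : bounded_op T).

Lemma rip_adjoint x y : rip (T x) y = rip x (adjoint T y).
Proof. by rewrite /rip (adjoint_spec hT).2. Qed.

Lemma positive_adjoint_comp : positive_op (adjoint T \o T).
Proof.
have e x y : rip ((adjoint T \o T) x) y = rip (T x) (T y).
  by rewrite ripC /= -rip_adjoint ripC.
split; first by apply: bounded_op_comp => //; case: (adjoint_spec hT).
  by move=> x y; rewrite e [RHS]ripC e ripC.
by move=> x; rewrite e ripxx sqr_ge0.
Qed.

Let half01 : 0 < (2^-1 : R) <= 1.
Proof. by rewrite invr_gt0 ltr0n invf_le1 ?ltr0n // ler1n. Qed.

Lemma positive_op_abs : positive_op (op_abs T).
Proof. exact: op_pow_positive positive_adjoint_comp _ half01. Qed.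

Lemma op_abs_sqr : op_abs T \o op_abs T = adjoint T \o T.
Proof.
have h : 2^-1 + 2^-1 = 1 :> R by rewrite -[X in X + _]div1r -[X in _ + X]div1r -splitr.
have /andP[h0 _] := half01.
by rewrite /op_abs op_powD ?h ?op_pow1 //; exact: positive_adjoint_comp.
Qed.

Lemma rnorm_op_abs x : rnorm (op_abs T x) = rnorm (T x).
Proof.
apply/eqP; rewrite -(@eqrXn2 _ 2) ?rnorm_ge0 // -!ripxx.
have [_ sB _] := positive_op_abs; rewrite -sB.
by rewrite -[op_abs T _]/((op_abs T \o op_abs T) x) op_abs_sqr ripC /= -rip_adjoint.
Qed.

Lemma op_abs_ker x : (op_abs T x == 0) = (T x == 0).
Proof.
by apply/eqP/eqP => h; apply: rnorm0_eq0; [rewrite -rnorm_op_abs|rewrite rnorm_op_abs];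
  rewrite h rnorm0.
Qed.

Lemma opnorm_op_abs : opnorm (op_abs T) <= opnorm T.
Proof. by apply: opnorm_le (opnorm_ge0 hT) _ => x; rewrite rnorm_op_abs ler_opnorm. Qed.

End AbsoluteValue.

Section PartialIsometry.
Variables (U : H -> H) (hU : bounded_op U).

Lemma closed_op_ker : closed_subspace (op_ker U).
Proof.
rewrite /op_ker; split=> /=; first exact: bounded_op0.
  by move=> a x y; rewrite hU.1 => -> ->; rewrite scaler0 addr0.
move=> x hx; apply/rnorm0_eq0/eqP; rewrite eq_le rnorm_ge0 andbT.
apply/ler_addgt0Pr => e e0; rewrite add0r.
have K0 : 0 < opnorm U + 1 by rewrite ltr_wpDl ?opnorm_ge0.
have [v /= Uv xv] := hx _ (divr_gt0 e0 K0).
have -> : U x = U (x - v) by rewrite bounded_opB // Uv subr0.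
apply: le_trans (ler_opnorm hU _) _; apply: le_trans (ler_wpM2l (opnorm_ge0 hU) xv) _.
by rewrite mulrC ler_divMl ?(ltW e0) // lerDl.
Qed.

Lemma ker_decomposition x : exists k y, [/\ x = k + y, U k = 0,
  (forall w, op_ker U w -> (<[y, w]> : R[i]) = 0) & rnorm y <= rnorm x].
Proof.
have [k Uk hk] := orthogonal_projection x closed_op_ker.
exists k, (x - k); split => //; first by rewrite addrC subrK.
rewrite -(@ler_pXn2r _ 2) ?nnegrE ?rnorm_ge0 //.
have -> : rnorm x ^+ 2 = rnorm (x - k) ^+ 2 + rnorm k ^+ 2.
  have := inner_rip0 (hk _ Uk); rewrite -!ripxx.
  move: (subrK k x); move: (x - k) => w <- h.
  by rewrite ripDl !ripDr (ripC k w) h addr0 add0r.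
by rewrite lerDl sqr_ge0.
Qed.

Hypothesis iU : partial_isometry U.

Lemma rnorm_partial_isometry x : rnorm (U x) <= rnorm x.
Proof.
have [k [y [-> Uk hy xy]]] := ker_decomposition x.
by rewrite bounded_opD // Uk add0r iU.
Qed.

(** Polarization on the orthogonal complement of ker U. Only [x] has to lie there: the kernel
    component of [y] is killed by [U] and is orthogonal to [x]. *)
Lemma rip_partial_isometry x y : (forall w, op_ker U w -> (<[x, w]> : R[i]) = 0) ->
  rip (U x) (U y) = rip x y.
Proof.
move=> hx; have [k [z [-> Uk hz _]]] := ker_decomposition y.
rewrite bounded_opD // Uk add0r ripDr (inner_rip0 (hx _ Uk)) add0r.
have h w : (forall v, op_ker U v -> (<[w, v]> : R[i]) = 0) -> rip (U w) (U w) = rip w w.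
  by move=> hw; rewrite !ripxx iU.
have hxz : rip (U (x + z)) (U (x + z)) = rip (x + z) (x + z).
  by apply: h => v kv; rewrite innerDl hx // hz // addr0.
move: hxz; rewrite bounded_opD // !ripDl !ripDr h // h // (ripC (U z)) (ripC z).
by move=> *; lra.
Qed.

(** Identifies the adjoint of [U] composed with [U], hence |T|^0, as the projection onto the
    orthogonal complement of ker U. *)
Lemma adjoint_partial_isometry x : (forall w, op_ker U w -> (<[x, w]> : R[i]) = 0) ->
  adjoint U (U x) = x.
Proof.
move=> hx; apply: eq_rip => z.
by rewrite ripC -rip_adjoint // ripC rip_partial_isometry.
Qed.

End PartialIsometry.

End OperatorPowers.

(** * Polar decomposition *)

Section PolarDecomposition.
Variables (R : realType) (H : hilbertType R) (T : H -> H).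
Hypothesis hT : bounded_op T.
Implicit Types (x y z u v w : H) (a : R[i]) (e t s : R).

Let B := op_abs T.
Let pB : positive_op B. Proof. exact: positive_op_abs. Qed.
Let hB : bounded_op B. Proof. by case: pB. Qed.
Let sB : symmetric_op B. Proof. by case: pB. Qed.

(* [graph_closure v u] says that (v, u) lies in the closure of the graph of the
   isometry |T| z |-> T z. *)
Let graph_closure v u :=
  forall e, 0 < e -> exists2 z, rnorm (v - B z) <= e & rnorm (u - T z) <= e.

Let range_closure v := forall e, 0 < e -> exists z, rnorm (v - B z) <= e.

Let graph_closure_linear a v u v' u' : graph_closure v u -> graph_closure v' u' ->
  graph_closure (a *: v + v') (a *: u + u').
Proof.
move=> h h' e e0; have K0 : 0 < rnorm a + 1 by rewrite ltr_wpDl ?rnorm_ge0.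
have [z h1 h2] := h _ (divr_gt0 e0 K0); have [z' h1' h2'] := h' _ (divr_gt0 e0 K0).
have aux (x x' y y' : H) : rnorm (x - y) <= e / (rnorm a + 1) ->
    rnorm (x' - y') <= e / (rnorm a + 1) -> rnorm (a *: x + x' - (a *: y + y')) <= e.
  move=> k k'; rewrite opprD addrACA -scalerBr; apply: le_trans (ler_rnormD _ _) _.
  rewrite rnormZ; apply: le_trans (lerD (ler_wpM2l (rnorm_ge0 a) k) k') _.
  by rewrite mulrC -{2}[e / _]mulr1 -mulrDr ler_divMl ?(ltW e0).
by exists (a *: z + z'); rewrite ?hB.1 ?hT.1; apply: aux.
Qed.

Let graph_closure_norm v u : graph_closure v u -> rnorm u = rnorm v.
Proof.
move=> h; apply/eqP; rewrite eq_le; apply/andP; split;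
  apply/ler_addgt0Pr => e e0; have [z h1 h2] := h _ (divr_gt0 e0 (ltr0n _ 2)).
- have : rnorm u <= rnorm (u - T z) + rnorm (T z) by rewrite -{1}[u](subrK (T z)) ler_rnormD.
  have : rnorm (B z) <= rnorm (v - B z) + rnorm v.
    by rewrite rnorm_distC -{1}[B z](subrK v) ler_rnormD.
  rewrite rnorm_op_abs //; move: h1 h2.
  by move: (rnorm _) (rnorm _) (rnorm _) (rnorm _) (rnorm _) => *; lra.
have : rnorm v <= rnorm (v - B z) + rnorm (B z) by rewrite -{1}[v](subrK (B z)) ler_rnormD.
have : rnorm (T z) <= rnorm (u - T z) + rnorm u.
  by rewrite rnorm_distC -{1}[T z](subrK u) ler_rnormD.
rewrite rnorm_op_abs //; move: h1 h2.
by move: (rnorm _) (rnorm _) (rnorm _) (rnorm _) (rnorm _) => *; lra.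
Qed.

(** If [B (z n)] converges to [v], then [T (z n)] is Cauchy because [T] and [B] have equal norms on
    every vector; its limit is the image of [v]. *)
Let graph_closure_total v : range_closure v -> exists u, graph_closure v u.
Proof.
move=> hv; have /choice[z hz] : forall n : nat, exists z, rnorm (v - B z) <= n.+1%:R^-1.
  by move=> n; apply: hv; rewrite invr_gt0 ltr0Sn.
have [|u hu] := @hilbert_complete _ _ (T \o z).
  move=> e e0; have [N hN] := invn_small (divr_gt0 e0 (ltr0n _ 2)).
  exists N => m n /hN hm /hN hn /=.
  rewrite -bounded_opB // -rnorm_op_abs // -/B bounded_opB //.
  have -> : B (z m) - B (z n) = (v - B (z n)) - (v - B (z m)).
    by rewrite opprB [RHS]addrC addrA subrK.
  apply: le_trans (ler_rnormD _ _) _; rewrite rnormN (splitr e).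
  by apply: lerD; [apply: le_trans hn|apply: le_trans hm].
exists u => e e0; have [N hN] := hu e e0; have [N' hN'] := invn_small e0.
exists (z (maxn N N')); last by rewrite rnorm_distC; apply/hN/leq_maxl.
by apply: le_trans (hz _) _; apply/hN'/leq_maxr.
Qed.

Let closed_range_closure : closed_subspace range_closure.
Proof.
split.
- by move=> e e0; exists 0; rewrite bounded_op0 // subrr rnorm0 ltW.
- move=> a x y /graph_closure_total[u xu] /graph_closure_total[u' yu'] e e0.
  by have [z hz _] := graph_closure_linear a xu yu' e0; exists z.
move=> x hx e e0; have e2 : 0 < e / 2 by rewrite divr_gt0.
have [v vc xv] := hx _ e2; have [z vz] := vc _ e2; exists z.
rewrite -[x](subrK v) -addrA; apply: le_trans (ler_rnormD _ _) _.
by rewrite (splitr e) lerD.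
Qed.

Let range_range_closure z : range_closure (B z).
Proof. by move=> e e0; exists z; rewrite subrr rnorm0 ltW. Qed.

Lemma range_op_abs_dense x : (forall z, (<[x, B z]> : R[i]) = 0) ->
  forall w, range_closure w -> (<[x, w]> : R[i]) = 0.
Proof.
move=> hx w hw; apply/rnorm0_eq0/eqP; rewrite eq_le rnorm_ge0 andbT.
apply/ler_addgt0Pr => e e0; rewrite add0r.
have K0 : 0 < rnorm x + 1 by rewrite ltr_wpDl ?rnorm_ge0.
have [z hz] := hw _ (divr_gt0 e0 K0).
rewrite -[w](subrK (B z)) innerDr hx addr0; apply: le_trans (inner_CS _ _) _.
apply: le_trans (ler_wpM2l (rnorm_ge0 x) hz) _.
by rewrite mulrC ler_divMl ?(ltW e0) // lerDl.
Qed.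

(** The graph of [U]: project [x] to [v] in the closed range of |T|, then apply the extended
    isometry. As a relation it can be proved linear and single-valued before a function is
    chosen. *)
Let polar_graph x u := exists v, [/\ range_closure v,
  forall w, range_closure w -> (<[x - v, w]> : R[i]) = 0 & graph_closure v u].

Let polar_graph_linear a x u x' u' : polar_graph x u -> polar_graph x' u' ->
  polar_graph (a *: x + x') (a *: u + u').
Proof.
move=> [v [cv ov gv]] [v' [cv' ov' gv']]; exists (a *: v + v'); split.
- by have [_ + _] := closed_range_closure; apply.
- by move=> w cw; rewrite opprD addrACA -scalerBr innerDl innerZl ov // ov' // mulr0 addr0.
exact: graph_closure_linear.
Qed.

Let polar_graph_norm x u : polar_graph x u -> rnorm u <= rnorm x.
Proof.
move=> [v [cv ov gv]]; rewrite (graph_closure_norm gv).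
rewrite -(@ler_pXn2r _ 2) ?nnegrE ?rnorm_ge0 // -!ripxx.
have := inner_rip0 (ov _ cv); move: (subrK v x); move: (x - v) => w <- h.
by rewrite ripDl !ripDr (ripC v w) h addr0 add0r lerDr ripxx sqr_ge0.
Qed.

(** By linearity [u - u'] is an image of 0, and images do not increase the norm. *)
Let polar_graph_uniq x u u' : polar_graph x u -> polar_graph x u' -> u = u'.
Proof.
move=> h h'; apply/eqP; rewrite -subr_eq0; apply/eqP/rnorm0_eq0/eqP.
have := polar_graph_norm (polar_graph_linear (-1) h' h).
by rewrite !scaleN1r !addNr rnorm0 eq_le rnorm_ge0 andbT addrC.
Qed.

Let polar_graph_op_abs z : polar_graph (B z) (T z).
Proof.
exists (B z); split=> //; first by move=> w _; rewrite subrr inner0l.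
by move=> e e0; exists z; rewrite subrr rnorm0 ltW.
Qed.

Let op_abs_orthogonal x : (forall z, (<[x, B z]> : R[i]) = 0) <-> T x = 0.
Proof.
split=> [h|Tx].
  have /eqP : B x = 0.
    by apply: eq_rip => z; rewrite rip0l sB; apply/inner_rip0/h.
  by rewrite op_abs_ker // => /eqP.
have /eqP Bx : B x == 0 by rewrite op_abs_ker // Tx.
by move=> z; rewrite inner_rip -!(bounded_opZ hB) -!sB Bx !rip0l.
Qed.

Lemma polarP : [/\ bounded_op (polar T), partial_isometry (polar T),
  T = polar T \o op_abs T & op_ker (polar T) = op_ker T].
Proof.
suff [U hU] : exists U : H -> H, [/\ bounded_op U, partial_isometry U,
    T = U \o op_abs T & op_ker U = op_ker T].
  by rewrite /polar; case: xgetP => [U' -> //|/(_ U)]; move/(_ hU).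
have /choice[U hU] : forall x, exists u, polar_graph x u.
  move=> x; have [v cv ov] := orthogonal_projection x closed_range_closure.
  by have [u gu] := graph_closure_total cv; exists u, v.
have linU : linear U.
  by move=> a x y; apply: polar_graph_uniq (hU _) (polar_graph_linear a (hU x) (hU y)).
have kerU x : U x = 0 <-> T x = 0.
  rewrite -op_abs_orthogonal; split=> [Ux z|h].
    have [v [cv ov gv]] := hU x; move: (graph_closure_norm gv).
    rewrite Ux rnorm0 => /esym/rnorm0_eq0 v0; rewrite v0 subr0 in ov.
    exact/ov/range_range_closure.
  apply: (polar_graph_uniq (hU x)); exists 0; split.
  - by case: closed_range_closure.
  - by rewrite subr0; exact: range_op_abs_dense.
  by move=> e e0; exists 0; rewrite bounded_op0 // subrr rnorm0 ltW.
exists U; split.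
- by split=> //; exists 1 => x; rewrite mul1r polar_graph_norm.
(* [x - v] is orthogonal to [v] and lies in ker U, to which [x] is orthogonal; hence [x = v] and [U]
   is isometric at [x]. *)
- move=> x hx; have [v [cv ov gv]] := hU x; rewrite (graph_closure_norm gv).
  have kxv : op_ker U (x - v).
    apply/kerU/op_abs_orthogonal => z; exact/ov/range_range_closure.
  suff : rnorm (x - v) = 0 by move/rnorm0_eq0/eqP; rewrite subr_eq0 => /eqP ->.
  apply/eqP; rewrite -sqrf_eq0 -ripxx ripDr ripNr (inner_rip0 (ov _ cv)) subr0.
  by rewrite ripC (inner_rip0 (hx _ kxv)).
- apply/funext => z; exact/esym/(polar_graph_uniq (hU _))/polar_graph_op_abs.
by apply/seteqP; split=> x; rewrite /op_ker /= kerU.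
Qed.

(** The orthogonal complement of the range of |T| is ker T. Strong continuity of |T|^t thereby
    reduces to these two subspaces. *)
Lemma ker_range_op_abs_dense x e : 0 < e ->
  exists k z, T k = 0 /\ rnorm (x - (k + op_abs T z)) <= e.
Proof.
move=> e0; have [v cv ov] := orthogonal_projection x closed_range_closure.
have [z vz] := cv e e0; exists (x - v), z; split.
  by apply/op_abs_orthogonal => w; exact/ov/range_range_closure.
by rewrite opprD opprB addrA [x + _]addrC subrK.
Qed.

End PolarDecomposition.

(** * The Aluthge transforms *)

Section PowerLipschitz.
Variable R : realType.
Implicit Types (x s t a b M : R).

(** The tangent line of [expR] at the larger point lies below the graph. *)
Lemma expR_dist a b : `|expR a - expR b| <= Num.max (expR a) (expR b) * `|a - b|.
Proof.
wlog ab : a b / b <= a.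
  move=> h; have [/h//|/ltW/h] := leP b a.
  by rewrite distrC maxC [`|b - a|]distrC.
have eab : expR b <= expR a by rewrite ler_expR.
rewrite max_l // !ger0_norm ?subr_ge0 //.
have := expR_ge1Dx (b - a); rewrite expRB => h.
have : expR a * (1 + (b - a)) <= expR b.
  by rewrite -[leRHS](@divfK _ (expR a)) ?gt_eqF ?expR_gt0 // mulrC ler_wpM2r ?expR_ge0.
by move: (expR a) (expR b) => u v; nra.
Qed.

Lemma mulr_ln_le x : 0 < x -> x * `|ln x| <= 1 + x ^+ 2.
Proof.
move=> x0; have l1 : x * ln x <= x ^+ 2 by rewrite expr2 ler_wpM2l ?ltW // ln_sublinear.
have l2 : x * - ln x <= 1.
  rewrite -lnV ?posrE // -[leRHS](@divff _ x) ?gt_eqF // ler_wpM2l ?(ltW x0) //.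
  by rewrite ltW // ln_sublinear ?invr_gt0.
have := sqr_ge0 x; case: (ger0P (ln x)) => _ ?; lra.
Qed.

Lemma powR_le1D x t : 0 <= x -> 0 <= t <= 1 -> x `^ t <= 1 + x.
Proof.
move=> x0 /andP[t0 t1]; have [x1|/ltW x1] := leP x 1.
  have : x `^ t <= 1 `^ t by rewrite ler_powRl.
  by rewrite powR1 => /le_trans; apply; rewrite lerDl.
have : x `^ t <= x `^ 1 by rewrite ler_powR.
by rewrite powRr1 // => /le_trans; apply; rewrite lerDr.
Qed.

Lemma powR_exp_dist x s t : 0 < x -> 0 <= s <= 1 -> 0 <= t <= 1 ->
  `|x `^ s - x `^ t| <= (1 + x) * (`|s - t| * `|ln x|).
Proof.
move=> x0 hs ht; rewrite /powR gt_eqF //.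
apply: le_trans (expR_dist _ _) _; rewrite -mulrBl normrM ler_wpM2r ?mulr_ge0 //.
have E r : expR (r * ln x) = x `^ r by rewrite /powR gt_eqF.
by rewrite !E ge_max !powR_le1D // ltW.
Qed.

(** [x^s - x^t] alone is of order [|s - t| |ln x|], unbounded near 0; the extra [x] turns this into
    [x |ln x| <= 1 + x^2]. At [x = 0] both products vanish, even for exponent 0. *)
Lemma mulr_powR_lipschitz M s t x : 0 <= s <= 1 -> 0 <= t <= 1 -> 0 <= x <= M ->
  `|x `^ s * x - x `^ t * x| <= (1 + M) * (1 + M ^+ 2) * `|s - t|.
Proof.
move=> hs ht /andP[x0 xM]; have M0 := le_trans x0 xM.
move: x0; rewrite [0 <= x]le_eqVlt => /predU1P[<-|x0].
  by rewrite !mulr0 subrr normr0 !mulr_ge0 // addr_ge0 ?sqr_ge0.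
rewrite -mulrBl normrM [`|x|]ger0_norm ?(ltW x0) //.
apply: le_trans (ler_wpM2r (ltW x0) (powR_exp_dist x0 hs ht)) _.
have -> : (1 + x) * (`|s - t| * `|ln x|) * x = (1 + x) * (x * `|ln x|) * `|s - t| by ring.
rewrite ler_wpM2r //; apply: ler_pM.
- by rewrite addr_ge0 // ltW.
- by rewrite mulr_ge0 // ltW.
- by rewrite lerD2l.
apply: le_trans (mulr_ln_le x0) _.
by rewrite lerD2l ler_pXn2r ?nnegrE // ltW.
Qed.

End PowerLipschitz.

(** * The factors |T|^t on [0, 1], the attained minimum, and the bound on T^2 *)

Section AluthgeTransform.
Variables (R : realType) (H : hilbertType R) (T : H -> H).
Hypothesis hT : bounded_op T.
Implicit Types (x y z : H) (e s t c : R).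

Local Notation U := (polar T).
Local Notation B := (op_abs T).
Local Notation P := (abs_pow T).

Let hU : bounded_op U. Proof. by case: (polarP hT). Qed.
Let iU : partial_isometry U. Proof. by case: (polarP hT). Qed.
Let UB x : U (B x) = T x.
Proof. by case: (polarP hT) => _ _ e _; rewrite [in RHS]e. Qed.
Let kerU x : U x = 0 <-> T x = 0.
Proof.
case: (polarP hT) => _ _ _ e.
by split=> h; [have : op_ker T x by rewrite -e|have : op_ker U x by rewrite e].
Qed.
Let pB : positive_op B. Proof. exact: positive_op_abs. Qed.
Let hB : bounded_op B. Proof. by case: pB. Qed.
Let sB : symmetric_op B. Proof. by case: pB. Qed.
Let kerB x : B x = 0 <-> T x = 0.
Proof. by split=> /eqP h; apply/eqP; rewrite ?op_abs_ker // -op_abs_ker. Qed.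

Let itv_cases t : 0 <= t <= 1 -> t = 0 \/ 0 < t <= 1.
Proof. by move=> /andP[]; rewrite le_eqVlt => /predU1P[<-|t0 t1]; [left|right; rewrite t0]. Qed.

Let Ppos t : 0 < t <= 1 -> P t = op_pow B t.
Proof. by move=> /andP[t0 _]; rewrite /abs_pow gt_eqF. Qed.

Let P0 : P 0 = adjoint U \o U.
Proof. by rewrite /abs_pow eqxx. Qed.

(** The range of |T| is orthogonal to ker T = ker U, and |T|^0 fixes that complement. *)
Let P0_op_abs x : P 0 (B x) = B x.
Proof.
rewrite P0 /=; apply: adjoint_partial_isometry => // w /kerU Tw.
have /kerB Bw : T w = 0 by [].
by rewrite inner_rip !sB (bounded_opZ hB) Bw scaler0 ripC rip0l.
Qed.

Let op_abs_P0 x : B (P 0 x) = B x.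
Proof.
rewrite P0 /=; have [k [y [-> Uk hy _]]] := ker_decomposition hU x.
rewrite bounded_opD // Uk add0r adjoint_partial_isometry // (bounded_opD hB).
by have /kerU/kerB -> := Uk; rewrite add0r.
Qed.

Lemma bounded_abs_pow t : 0 <= t <= 1 -> bounded_op (P t).
Proof.
move=> /itv_cases[->|ht]; last by rewrite Ppos //; case: (op_pow_positive pB ht).
by rewrite P0; apply: bounded_op_comp => //; case: (adjoint_spec hU).
Qed.

Lemma symmetric_abs_pow t : 0 <= t <= 1 -> symmetric_op (P t).
Proof.
move=> /itv_cases[->|ht]; last by rewrite Ppos //; case: (op_pow_positive pB ht).
by rewrite P0; case: (positive_adjoint_comp hU).
Qed.

Lemma opnorm_abs_pow t : 0 <= t <= 1 -> opnorm (P t) <= opnorm T `^ t.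
Proof.
move=> /itv_cases[->|ht].
  rewrite powRr0 P0; apply: opnorm_le => // x; rewrite mul1r /=.
  have [k [y [-> Uk hy xy]]] := ker_decomposition hU x.
  by rewrite bounded_opD // Uk add0r adjoint_partial_isometry.
rewrite Ppos //; apply: le_trans (opnorm_op_pow pB ht) _.
by rewrite ler_powRl ?opnorm_ge0 ?opnorm_op_abs //; case/andP: ht => /ltW.
Qed.

Let onem_itv t : 0 <= t <= 1 -> 0 <= 1 - t <= 1.
Proof. by move=> /andP[*]; apply/andP; split; lra. Qed.

(** Inside (0, 1) this is the law of exponents; at both endpoints the convention for |T|^0 enters
    and one factor is a projection absorbed by |T|. *)
Lemma abs_pow_onem t x : 0 <= t <= 1 -> P (1 - t) (P t x) = B x.
Proof.
have h1 : 0 < (1 : R) <= 1 by rewrite ltr01 lexx.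
have P1 : P 1 = B by rewrite Ppos // op_pow1.
move=> ht; have [->|t0] := itv_cases ht; first by rewrite subr0 P1 op_abs_P0.
have [e|t'0] := itv_cases (onem_itv ht).
  have t1 : t = 1 by lra.
  by rewrite t1 subrr P1 P0_op_abs.
rewrite !Ppos // -[LHS]/((op_pow B (1 - t) \o op_pow B t) x).
by rewrite op_powD ?subrK ?op_pow1 //; [case/andP: t'0|case/andP: t0].
Qed.

(** Composition with |T| brings [t = 0] back into the functional calculus: [r^0 r = r], also at
    [r = 0]. *)
Lemma abs_pow_range_calc t : 0 <= t <= 1 -> is_calc B (fun r => r `^ t * r) (P t \o B).
Proof.
move=> /itv_cases[->|ht].
  have -> : P 0 \o B = B by apply/funext => x; exact: P0_op_abs.
  by apply: eq_is_calc (is_calc_id pB) => r _; rewrite powRr0 mul1r.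
rewrite Ppos //; exact: (is_calc_mul pB (op_powP pB ht) (is_calc_id pB)).
Qed.

Lemma abs_pow_ker t x : 0 <= t <= 1 -> T x = 0 -> P t x = 0.
Proof.
move=> /itv_cases[->|ht] Tx.
  have /kerU Ux := Tx; rewrite P0 /= Ux; apply: bounded_op0.
  by case: (adjoint_spec hU).
by rewrite Ppos // op_pow_ker //; apply/kerB.
Qed.

Let N1 : 0 < 1 + opnorm T. Proof. by rewrite ltr_pwDl // opnorm_ge0. Qed.

Let rnorm_abs_pow t x : 0 <= t <= 1 -> rnorm (P t x) <= (1 + opnorm T) * rnorm x.
Proof.
move=> ht; apply: le_trans (ler_opnorm (bounded_abs_pow ht) x) _.
rewrite ler_wpM2r ?rnorm_ge0 //; apply: le_trans (opnorm_abs_pow ht) _.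
by rewrite powR_le1D ?opnorm_ge0.
Qed.

Lemma abs_pow_continuous x e : 0 < e -> exists2 d : R, 0 < d &
  forall s t, 0 <= s <= 1 -> 0 <= t <= 1 -> `|s - t| <= d -> rnorm (P s x - P t x) <= e.
Proof.
move=> e0; have e4 : 0 < e / 4 by rewrite divr_gt0.
(* The residue [u] costs at most [e / 4] under each of the two powers by the uniform bound
   [1 + opnorm T], [k] is annihilated, and the range part gets the remaining [e / 2] through the
   Lipschitz constant [C]. *)
have [k [z [Tk hz]]] := ker_range_op_abs_dense hT x (divr_gt0 e4 N1).
set u := x - _ in hz.
pose C := (1 + opnorm B) * (1 + opnorm B ^+ 2).
have C0 : 0 <= C by rewrite mulr_ge0 ?addr_ge0 ?sqr_ge0 ?opnorm_ge0.
have K0 : 0 < C * rnorm z + 1 by rewrite ltr_wpDl // mulr_ge0 ?rnorm_ge0.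
have e2 : 0 < e / 2 by rewrite divr_gt0.
exists (e / 2 / (C * rnorm z + 1)); first by rewrite divr_gt0.
move=> s t hs ht st.
have hPu r : 0 <= r <= 1 -> rnorm (P r u) <= e / 4.
  move=> hr; apply: le_trans (rnorm_abs_pow u hr) _.
  apply: le_trans (ler_wpM2l (ltW N1) hz) _.
  by rewrite mulrC divfK ?gt_eqF.
have Px r : 0 <= r <= 1 -> P r x = P r u + P r (B z).
  move=> hr; have hPr := bounded_abs_pow hr.
  rewrite -{1}[x](subrK (k + B z)) -/u (bounded_opD hPr) (bounded_opD hPr).
  by rewrite (abs_pow_ker hr Tk) add0r.
have hPB : rnorm (P s (B z) - P t (B z)) <= e / 2.
  have cst := is_calc_sub pB (abs_pow_range_calc hs) (abs_pow_range_calc ht).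
  have h : opnorm ((P s \o B) - (P t \o B)) <= C * `|s - t|.
    by apply: (is_calc_opnorm pB cst) => r hr; exact: mulr_powR_lipschitz.
  have -> : P s (B z) - P t (B z) = ((P s \o B) - (P t \o B)) z by [].
  apply: le_trans (ler_opnorm cst.1 _) _.
  apply: le_trans (ler_wpM2r (rnorm_ge0 z) h) _.
  rewrite -mulrA [_ * rnorm z]mulrC mulrA mulrC.
  apply: le_trans (ler_wpM2r _ st) _; first by rewrite mulr_ge0 ?rnorm_ge0.
  by rewrite ler_divMl ?(ltW e2) // lerDl.
rewrite !Px // opprD addrACA; apply: le_trans (ler_rnormD _ _) _.
have := ler_rnormD (P s u) (- P t u); rewrite rnormN.
have := hPu s hs; have := hPu t ht; move: hPB.
move: (rnorm _) (rnorm (P t u)) (rnorm (P s u)) (rnorm _) => *; lra.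
Qed.

Lemma bounded_t_aluthge t : 0 <= t <= 1 -> bounded_op (t_aluthge t T).
Proof.
move=> ht; apply: bounded_op_comp (bounded_abs_pow (onem_itv ht)).
exact: bounded_op_comp (bounded_abs_pow ht) hU.
Qed.

(** Moving the symmetric outer factor to [y] leaves [rip (U |T|^(1-t) x) (|T|^t y)], where strong
    continuity applies to each side separately. *)
Lemma t_aluthge_continuous x y e : 0 < e -> exists2 d : R, 0 < d &
  forall s t, 0 <= s <= 1 -> 0 <= t <= 1 -> `|s - t| <= d ->
    `|rip (t_aluthge s T x) y - rip (t_aluthge t T x) y| <= e.
Proof.
move=> e0; pose K := (1 + opnorm T) * (rnorm x + rnorm y) + 1.
have K0 : 0 < K by rewrite ltr_wpDl // mulr_ge0 ?addr_ge0 ?rnorm_ge0 ?opnorm_ge0.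
have [d1 d10 h1] := abs_pow_continuous x (divr_gt0 e0 K0).
have [d2 d20 h2] := abs_pow_continuous y (divr_gt0 e0 K0).
exists (Num.min d1 d2); first by rewrite lt_min d10.
move=> s t hs ht; rewrite le_min => /andP[sd1 sd2].
have E r : 0 <= r <= 1 -> rip (t_aluthge r T x) y = rip (U (P (1 - r) x)) (P r y).
  by move=> hr; rewrite /t_aluthge /= symmetric_abs_pow.
rewrite !E //.
have -> : rip (U (P (1 - s) x)) (P s y) - rip (U (P (1 - t) x)) (P t y) =
   rip (U (P (1 - s) x - P (1 - t) x)) (P s y) + rip (U (P (1 - t) x)) (P s y - P t y).
  by rewrite (bounded_opB hU) ripDl ripDr ripNl ripNr; ring.
apply: le_trans (ler_normD _ _) _; apply: le_trans (lerD (rip_CS _ _) (rip_CS _ _)) _.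
have os := onem_itv hs; have ot := onem_itv ht.
have st : `|1 - s - (1 - t)| <= d1.
  by rewrite (_ : 1 - s - (1 - t) = t - s) 1?distrC //; ring.
have k1 : rnorm (U (P (1 - s) x - P (1 - t) x)) * rnorm (P s y) <=
    e / K * ((1 + opnorm T) * rnorm y).
  apply: ler_pM; rewrite ?rnorm_ge0 ?rnorm_abs_pow //.
  by apply: le_trans (rnorm_partial_isometry hU iU _) _; exact: h1.
have k2 : rnorm (U (P (1 - t) x)) * rnorm (P s y - P t y) <=
    (1 + opnorm T) * rnorm x * (e / K).
  apply: ler_pM; rewrite ?rnorm_ge0 ?h2 //.
  by apply: le_trans (rnorm_partial_isometry hU iU _) _; rewrite rnorm_abs_pow.
apply: le_trans (lerD k1 k2) _.
have -> : e / K * ((1 + opnorm T) * rnorm y) + (1 + opnorm T) * rnorm x * (e / K) =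
  e / K * ((1 + opnorm T) * (rnorm x + rnorm y)) by ring.
by rewrite ler_divMl ?(ltW e0) // /K lerDl.
Qed.

Lemma opnorm_t_aluthge_min : exists2 t0 : R, 0 <= t0 <= 1 &
  forall t, 0 <= t <= 1 -> opnorm (t_aluthge t0 T) <= opnorm (t_aluthge t T).
Proof.
pose F t := opnorm (t_aluthge t T).
pose D := [set F t | t in [set t : R | 0 <= t <= 1]].
have hD : has_inf D.
  split; first by exists (F 0), 0 => //=; rewrite lexx ler01.
  by exists 0 => _ [t /= ht <-]; rewrite opnorm_ge0 //; exact: bounded_t_aluthge.
have mF t : 0 <= t <= 1 -> inf D <= F t.
  by move=> ht; apply: ge_inf; [exact: hD.2|exists t].
have /choice[u hu] : forall n : nat, exists t, 0 <= t <= 1 /\ F t <= inf D + n.+1%:R^-1.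
  move=> n; have [|_ [t ht <-] /ltW h] := @inf_adherent _ D n.+1%:R^-1 _ hD.
    by rewrite invr_gt0 ltr0Sn.
  by exists t.
have [|f fi /cvg_ex[l /= ul]] := bolzano_weierstrass (u_ := u).
  exists 1; split=> // M M1 n _ /=; have [/andP[u0 u1] _] := hu n.
  by rewrite ger0_norm // (le_trans u1) // ltW.
(* Guarantees that the excess [1 / (f n + 1)] over the infimum tends to 0 along the subsequence. *)
have fn n : (n <= f n)%N.
  elim: n => // n IH; apply: leq_ltn_trans IH _.
  by rewrite ltnNge; apply/negP => h; move: (fi n.+1 n); rewrite /= leEnat h ltnn.
have lim e : 0 < e -> exists N, forall n, (N <= n)%N -> `|u (f n) - l| <= e.
  move=> e0; have [N _ hN] := (cvgrPdist_le _ _).1 ul _ e0.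
  by exists N => n /hN; rewrite distrC.
have hl : 0 <= l <= 1.
  apply/andP; split; apply/ler_addgt0Pr => e /lim[N /(_ N (leqnn N))];
  by have [/andP[u0 u1] _] := hu (f N); rewrite ler_norml => /andP[*]; lra.
exists l => // t ht; apply: le_trans (mF t ht).
have m0 : 0 <= inf D.
  by apply: lb_le_inf hD.1 _ => _ [r /= hr <-]; apply/opnorm_ge0/bounded_t_aluthge.
(* Lower semicontinuity: a bound on all [rip (t_aluthge l T x) y] yields the norm bound, and each of
   these is a limit along the minimizing sequence. *)
apply: opnorm_le => // x; apply: rnorm_le_rip => [|y].
  by rewrite mulr_ge0 ?rnorm_ge0.
apply/ler_addgt0Pr => e e0; pose K := rnorm x * rnorm y + 1.
have K0 : 0 < K by rewrite ltr_wpDl // mulr_ge0 ?rnorm_ge0.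
have e2 : 0 < e / 2 by rewrite divr_gt0.
have [d d0 hd] := t_aluthge_continuous x y e2.
have [n1 hN1] := lim d d0; have [n2 hN2] := invn_small (divr_gt0 e2 K0).
pose n := maxn n1 n2; have [hn Fn] := hu (f n).
have h1 := hd _ _ hn hl (hN1 n (leq_maxl _ _)).
have h2 : rip (t_aluthge (u (f n)) T x) y <= (inf D + (f n).+1%:R^-1) * (rnorm x * rnorm y).
  apply: le_trans (ler_rip _ _) _; rewrite mulrA ler_wpM2r ?rnorm_ge0 //.
  apply: le_trans (ler_opnorm (bounded_t_aluthge hn) x) _.
  by rewrite ler_wpM2r ?rnorm_ge0.
have h3 : (f n).+1%:R^-1 * (rnorm x * rnorm y) <= e / 2.
  have := hN2 (f n) (leq_trans (leq_maxr _ _) (fn n)) => h.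
  apply: le_trans (ler_wpM2r _ h) _; first by rewrite mulr_ge0 ?rnorm_ge0.
  by rewrite ler_divMl ?(ltW e2) // /K lerDl.
move: h1 h2 h3; rewrite ler_norml mulrDl -mulrA => /andP[h1 _] h2 h3; move: h1 h2 h3.
move: (rip _ _) (rip _ _) (inf D * _) (_^-1 * _) => *; lra.
Qed.

Lemma rnorm_sqr_t_aluthge t x : 0 <= t <= 1 ->
  rnorm (T (T x)) <= opnorm T * opnorm (t_aluthge t T) * rnorm x.
Proof.
move=> ht; have ot := onem_itv ht.
have -> : T (T x) = U (P (1 - t) (t_aluthge t T (P t x))).
  by rewrite /t_aluthge /= !abs_pow_onem // !UB.
apply: le_trans (rnorm_partial_isometry hU iU _) _.
have hP := bounded_abs_pow ht; have hP' := bounded_abs_pow ot.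
have hA := bounded_t_aluthge ht.
apply: le_trans (ler_opnorm hP' _) _.
apply: le_trans (ler_wpM2l (opnorm_ge0 hP') (ler_opnorm hA _)) _.
rewrite mulrA.
apply: le_trans (ler_wpM2l _ (ler_opnorm hP x)) _; first by rewrite mulr_ge0 ?opnorm_ge0.
rewrite mulrA ler_wpM2r ?rnorm_ge0 // mulrAC ler_wpM2r ?opnorm_ge0 //.
(* The exponents add up to 1, so this splitting holds even if [opnorm T = 0]. *)
have -> : opnorm T = opnorm T `^ (1 - t) * opnorm T `^ t.
  by rewrite -powRD ?subrK ?powRr1 ?opnorm_ge0 // oner_eq0.
by rewrite ler_pM ?opnorm_ge0 ?opnorm_abs_pow.
Qed.

End AluthgeTransform.

(** * The numerical radius *)

Section NumericalRadius.
Variables (R : realType) (H : hilbertType R) (T : H -> H).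
Hypothesis hT : bounded_op T.

(* With |c| = 1 and c <T x, x> = |<T x, x>|, one has
   2 |<T x, x>| <= |c T x + c^* T^* x|; expanding the square of the right-hand
   side leaves <(T^* T + T T^* ) x, x> and 2 Re (c^2 <T^2 x, x>). *)
Lemma num_radius_sqr_le (c : R) : 0 <= c ->
  (forall x, rnorm (T (T x)) <= c * rnorm x) ->
  num_radius T ^+ 2 <= 2^-1 * c + 4^-1 * opnorm ((adjoint T \o T) + (T \o adjoint T)).
Proof.
move=> c0 hc; have [hV eV] := adjoint_spec hT.
set V := adjoint T in hV eV *; set S := (V \o T) + (T \o V).
have hS : bounded_op S by apply: bounded_op_add; apply: bounded_op_comp.
set r := _ + _.
have r0 : 0 <= r by rewrite addr_ge0 ?mulr_ge0 ?opnorm_ge0 ?invr_ge0.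
suff key x : rnorm x = 1 -> rnorm (<[T x, x]> : R[i]) ^+ 2 <= r.
  (* In the zero space there is no unit vector, and the supremum of the empty set is 0. *)
  have [[x /= x1]|nx] := pselect (exists x : H, rnorm x = 1); last first.
    rewrite /num_radius (_ : [set _ | _ in _] = set0) ?sup0 ?expr0n //.
    by apply/seteqP; split=> // a [x /= x1 _]; case: nx; exists x.
  have le a : [set rnorm (<[T x, x]> : R[i]) | x in [set x : H | rnorm x = 1]] a ->
      a <= Num.sqrt r.
    move=> [y /= /key h <-]; rewrite -[leLHS]ger0_norm ?rnorm_ge0 // -sqrtr_sqr.
    by rewrite ler_sqrt.
  have inx : [set rnorm (<[T x, x]> : R[i]) | x in [set x : H | rnorm x = 1]]
      (rnorm (<[T x, x]> : R[i])) by exists x.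
  have s1 : num_radius T <= Num.sqrt r by apply: ge_sup => //; exists (rnorm (<[T x, x]> : R[i])).
  have s0 : 0 <= num_radius T.
    apply: le_trans (rnorm_ge0 (<[T x, x]> : R[i])) _; apply: sup_ubound => //.
    by exists (Num.sqrt r).
  rewrite -[leRHS]sqr_sqrtr //; rewrite ler_pXn2r ?nnegrE ?sqrtr_ge0 //.
move=> x1; have [d d1 hd] := unimodular_rotation (<[T x, x]> : R[i]).
set a := rnorm _ in hd *.
have dJ : rnorm (d^*%C) = 1.
  by rewrite -d1 /rnorm normcJ.
pose y := d *: T x + d^*%C *: V x.
have yx : rip y x = 2 * a.
  rewrite ripDl {1}/rip innerZl hd /= /rip innerZl [<[V x, x]>]innerC -eV.
  have -> : d^*%C * (<[T x, x]> : R[i])^*%C = (d * <[T x, x]>)^*%C by rewrite rmorphM.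
  by rewrite hd /=; ring.
have ay : 2 * a <= rnorm y by rewrite -yx (le_trans (ler_rip _ _)) // x1 mulr1.
have a0 : 0 <= a by exact: rnorm_ge0.
(* Since [<T x, V x> = <T (T x), x>], this is where the bound [c] on [T^2] enters. *)
have cross : rip (d *: T x) (d^*%C *: V x) <= c.
  rewrite /rip innerZl innerZr conjcK mulrA -eV -innerZl -/(rip _ _).
  by apply: le_trans (ler_rip _ _) _; rewrite rnormZ rnormM d1 !mul1r x1 mulr1 -[c]mulr1 -x1.
have y2 : rnorm y ^+ 2 = rip (S x) x + 2 * rip (d *: T x) (d^*%C *: V x).
  rewrite -ripxx ripDl !ripDr (ripC (_ *: V x)) !ripxx !rnormZ d1 dJ !mul1r.
  have -> : S x = V (T x) + T (V x) by [].
  have e1 : rip (V (T x)) x = rnorm (T x) ^+ 2 by rewrite ripC -(rip_adjoint hT) ripxx.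
  have e2 : rip (T (V x)) x = rnorm (V x) ^+ 2 by rewrite (rip_adjoint hT) ripxx.
  by rewrite ripDl e1 e2; ring.
have Sx : rip (S x) x <= opnorm S.
  apply: le_trans (ler_rip _ _) _; apply: le_trans (ler_wpM2r (rnorm_ge0 x) (ler_opnorm hS x)) _.
  by rewrite x1 !mulr1.
have a2 : (2 * a) ^+ 2 <= rnorm y ^+ 2 by rewrite ler_pXn2r ?nnegrE ?rnorm_ge0 // mulr_ge0.
(* [4 a^2 <= opnorm S + 2 c], which after division by 4 gives the constants 1/4 and 1/2. *)
rewrite exprMn y2 in a2; rewrite /r.
by move: a2 cross Sx; move: (rip _ _) (rip _ _) (opnorm S) (a ^+ 2) => *; lra.
Qed.

End NumericalRadius.

Theorem theorem2p5 (R : realType) (H : hilbertType R) (T : H -> H)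
    (hT : bounded_op T) :
  (exists t0 : R,
     [/\ 0 <= t0 <= 1,
         forall t : R, 0 <= t <= 1 ->
           opnorm (t_aluthge t0 T) <= opnorm (t_aluthge t T) &
         num_radius T ^+ 2 <=
           2^-1 * opnorm T * opnorm (t_aluthge t0 T) +
           4^-1 * opnorm ((adjoint T \o T) + (T \o adjoint T))]) /\
  num_radius T ^+ 2 <=
    2^-1 * opnorm T * opnorm (aluthge T) +
    4^-1 * opnorm ((adjoint T \o T) + (T \o adjoint T)).
Proof.
have bound t : 0 <= t <= 1 -> num_radius T ^+ 2 <=
    2^-1 * opnorm T * opnorm (t_aluthge t T) +
    4^-1 * opnorm ((adjoint T \o T) + (T \o adjoint T)).
  move=> ht; rewrite -mulrA; apply: num_radius_sqr_le => //.
    by rewrite mulr_ge0 ?opnorm_ge0 //; exact: bounded_t_aluthge.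
  by move=> x; exact: rnorm_sqr_t_aluthge.
split.
  have [t0 t01 ht0] := opnorm_t_aluthge_min hT.
  by exists t0; split=> //; exact: bound.
have -> : aluthge T = t_aluthge 2^-1 T.
  by rewrite /aluthge /t_aluthge (_ : 1 - 2^-1 = 2^-1) //; field.
by apply: bound; apply/andP; split; lra.
Qed.
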